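(* Let $\mu\ge1$. The generalized Mathieu series admits, for $r>0$, the integral representation $$S_\mu(r)=c_\mu\int_0^\infty e^{-rt}K_\mu(t)\,dt,$$ and $$\zeta(2\mu+1)=\frac{c_\mu}{2}\int_0^\infty K_\mu(t)\,dt,$$ and, for $r>0$, $$S(r)=\int_0^\infty e^{-rt}K(t)\,dt,$$ where $c_\mu=\frac{\sqrt{\pi}}{2^{\mu-1/2}\,\Gamma(\mu+1)}$, $K_\mu(t)=t^{\mu+1/2}g_\mu(t)$ and $K(t)=h(t)-t\,h'(t)$, with $$g_\mu(t)=\sum_{n=1}^\infty\frac{J_{\mu+1/2}(nt)}{n^{\mu-1/2}},\qquad h(t)=\sum_{n=1}^\infty\frac{\sin(nt)}{n^2}.$$
   Context: For $\mu>0$ and $r>0$, the generalized Mathieu series is $S_\mu(r)=\sum_{n=1}^\infty \frac{2n}{(n^2+r^2)^{\mu+1}}$, and the Mathieu series is $S(r)=S_1(r)=\sum_{n=1}^\infty\frac{2n}{(n^2+r^2)^2}$. $J_\nu$ denotes the Bessel function of the first kind of order $\nu$, $\Gamma$ the Gamma function and $\zeta$ the Riemann zeta function.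
   Formalization: In the formula for ζ(2μ+1) the integral of K_μ over (0,∞) diverges for every μ≥1 as a Lebesgue or improper integral; it is taken in the Abel sense, as the limit of ∫ e^{-rt} K_μ(t) dt when r→0+. *)

(* Defs.v *)
(* MathComp-Analysis *)
From HB Require Import structures.
From mathcomp Require Import all_boot all_order all_algebra.
From mathcomp Require Import all_classical all_reals all_analysis.

Set Implicit Arguments.
Unset Strict Implicit.
Unset Printing Implicit Defensive.

Import Order.TTheory GRing.Theory Num.Theory.
Import numFieldNormedType.Exports.

Local Open Scope classical_set_scope.
Local Open Scope ring_scope.

(* Euler's integral; it is Gamma only for 0 < a, the range used below. *)
Definition Gamma (R : realType) (a : R) : R :=
  \int[lebesgue_measure]_(t in `]0, +oo[) (t `^ (a - 1) * expR (- t)).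

(* Power series at 0; it is J_nu(x) for -1 < nu and 0 < x. Other (nu, x) would
   need the continuation of 1 / Gamma and complex powers of x / 2. *)
Definition BesselJ (R : realType) (nu x : R) : R :=
  \big[+%R/0]_(0 <= m <oo)
     ((-1) ^+ m / (m`!%:R * Gamma (m%:R + nu + 1))
      * (x / 2) `^ (2 * m%:R + nu)).

(* The Dirichlet series; it is the Riemann zeta function for 1 < s. *)
Definition zeta (R : realType) (s : R) : R :=
  \big[+%R/0]_(1 <= n <oo) n%:R `^ (- s).

Definition gen_mathieu (R : realType) (mu r : R) : R :=
  \big[+%R/0]_(1 <= n <oo) (2 * n%:R / (n%:R ^+ 2 + r ^+ 2) `^ (mu + 1)).

Definition mathieu (R : realType) (r : R) : R := gen_mathieu 1 r.

Definition c_ (R : realType) (mu : R) : R :=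
  Num.sqrt pi / (2 `^ (mu - 1 / 2) * Gamma (mu + 1)).

(* For mu = 1 this series, like the termwise derivative of h below, diverges at
   the positive multiples of 2 pi. The value chosen there is arbitrary and,
   these points being a null set, does not affect the integrals. *)
Definition g_ (R : realType) (mu t : R) : R :=
  \big[+%R/0]_(1 <= n <oo)
     (BesselJ (mu + 1 / 2) (n%:R * t) / n%:R `^ (mu - 1 / 2)).

Definition K_ (R : realType) (mu t : R) : R := t `^ (mu + 1 / 2) * g_ mu t.

Definition h (R : realType) (t : R) : R :=
  \big[+%R/0]_(1 <= n <oo) (sin (n%:R * t) / n%:R ^+ 2).

Definition K (R : realType) (t : R) : R := h t - t * derive1 (@h R) t.

Definition laplace_integrable (R : realType) (f : R -> R) (r : R) : Prop :=
  lebesgue_measure.-integrable `]0, +oo[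
    (EFin \o (fun t : R => expR (- (r * t)) * f t)).

Definition laplace (R : realType) (f : R -> R) (r : R) : R :=
  \int[lebesgue_measure]_(t in `]0, +oo[) (expR (- (r * t)) * f t).

(* The integral of f over ]0, +oo[ exists in the sense of Abel and equals l.
   The value l is that of the Lebesgue integral, or of the improper integral,
   when these exist too. For the kernels K_ mu with 1 <= mu neither of them does:
   K_ mu oscillates at infinity, growing like t ^ mu, so that its integral over
   ]0, +oo[ only makes sense as an Abel limit. *)
Definition abel_integral (R : realType) (f : R -> R) (l : R) : Prop :=
  (forall r : R, 0 < r -> laplace_integrable f r) /\
  laplace f r @[r --> 0^'+] --> l.

(* Main.v *)
(** For [nu >= 1/2] and [c > 0], the Laplace transform of [t ^ nu J_nu (c t)] at [r] is a
    constant times [c ^ nu (c ^ 2 + r ^ 2) ^ (- nu - 1/2)]. The usual termwise integration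
    of the Bessel series is only valid for [c < r] and needs analytic continuation;
    instead [exp (- r t)] is written as a mixture of Gaussians in [t], against which the
    Bessel series can be integrated termwise for every [c]. With [nu = mu + 1/2] and
    [c = n], summing over [n] gives [S_mu]. The interchange is dominated: for [mu > 1] the
    decay [J_nu (x) = O (x ^ (- 1/2))] makes the sum absolutely convergent. For [mu = 1] it
    is not, and [J_(3/2)] is elementary, which reduces the series to the sums of
    [sin (n t) / n ^ 2] and [cos (n t) / n]; Abel summation bounds the latter by
    [\sum_k |D_k (t)| / k ^ 2], with [D_k] the cosine sums, and this is integrable because
    the weighted mean square of [D_k] is [O (k)]. Off the countably many zeros of
    [sin (t / 2)] one also has [h' (t) = \sum_n cos (n t) / n], hence [K = c_1 K_1].
    The zeta value follows from [|2 zeta (2 mu + 1) - S_mu (r)| = O (r ^ 2)]. *)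

(* Against a Gaussian the moment of order [2 m + 2 nu + 1] is proportional to [Gamma (m + nu + 1)].
   It cancels the Gamma factor of the [m]-th Bessel coefficient exactly and leaves an exponential
   series, entire in [c]. Against [exp (- r t)] the [m]-th moment grows like
   [Gamma (2 m + 2 nu + 1)], and the resulting series is binomial in [c / r]; this is the origin of
   the restriction [c < r]. For [mu = 1] neither pointwise bound of the cosine sums [D_k] yields a
   majorant: [|D_k| <= k] leaves a harmonic series, and [|D_k| <= 1 / |sin (t / 2)|] is not
   integrable at the positive multiples of [2 pi]. The mean square lies in between: since its
   weighted integral is [O (k)], each [|D_k|] costs only [sqrt k], and the sum of [sqrt k / k ^ 2]
   converges. The majorants are series of nonnegative functions with summable integrals. They may be
   infinite at some points, which is why domination is expressed in the extended reals. *)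
Require Import Defs.
From mathcomp Require Import all_boot all_order all_algebra.
From mathcomp Require Import all_classical all_reals all_analysis.
From mathcomp Require Import measurable_realfun ring lra.

Set Implicit Arguments.
Unset Strict Implicit.
Unset Printing Implicit Defensive.

Import Order.TTheory GRing.Theory Num.Theory.
Import numFieldNormedType.Exports.
Local Open Scope classical_set_scope.
Local Open Scope ring_scope.

(** * Integrals over the positive half-line *)

Section has_integral.
Context {R : realType}.
Implicit Types (f g F : R -> R) (v w : R).
Notation mu := (@lebesgue_measure R).
Notation D0 := (`]0, +oo[%classic : set R).

(** Integrability and value are kept together: an integral known in closed form can then serve at
    once as a majorant. *)
Definition has_integral f v :=
  mu.-integrable D0 (EFin \o f) /\ (\int[mu]_(x in D0) (f x)%:E = v%:E)%E.

Lemma has_integral_Rintegral f v : has_integral f v -> \int[mu]_(x in D0) f x = v.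
Proof. by move=> [_]; rewrite /Rintegral => ->. Qed.

Lemma has_integral_unique f v w : has_integral f v -> has_integral f w -> v = w.
Proof. by move=> /has_integral_Rintegral <- /has_integral_Rintegral. Qed.

Lemma integrable_has_integral f : mu.-integrable D0 (EFin \o f) ->
  has_integral f (\int[mu]_(x in D0) f x).
Proof. by move=> fi; split => //; rewrite /Rintegral fineK//; exact: integrable_fin_num. Qed.

Lemma has_integral_measurable f v : has_integral f v -> measurable_fun D0 f.
Proof. by move=> [/measurable_int/measurable_EFinP]. Qed.

Lemma eq_has_integral f g v : (forall x : R, 0 < x -> f x = g x) ->
  has_integral f v -> has_integral g v.
Proof.
move=> fg [fi fv]; split.
  by apply: eq_integrable fi => // x; rewrite inE/= in_itv/= andbT => /fg ->.
by rewrite -fv; apply: eq_integral => x; rewrite inE/= in_itv/= andbT => /fg ->.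
Qed.

Lemma has_integralZ k f v : has_integral f v -> has_integral (fun x => k * f x) (k * v).
Proof.
move=> [fi fv]; split; first exact: (integrableZl _ _ fi).
under eq_integral do rewrite EFinM.
by rewrite (integralZl _ fi)// fv EFinM.
Qed.

Lemma has_integralD f g v w : has_integral f v -> has_integral g w ->
  has_integral (fun x => f x + g x) (v + w).
Proof.
move=> [fi fv] [gi gw]; split.
  by apply: eq_integrable (integrableD _ fi gi).
under eq_integral do rewrite EFinD.
by rewrite integralD//= fv gw EFinD.
Qed.

Lemma has_integralB f g v w : has_integral f v -> has_integral g w ->
  has_integral (fun x => f x - g x) (v - w).
Proof.
move=> hf /(has_integralZ (-1)) hg; have := has_integralD hf hg.
rewrite mulN1r; apply: eq_has_integral => x _ /=; by rewrite mulN1r.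
Qed.

Lemma has_integral0 : has_integral (fun=> 0) 0.
Proof. by split; [exact: integrable0|rewrite integral0]. Qed.

Lemma has_integral_sum (f : nat -> R -> R) (v : nat -> R) m n :
  (forall k, has_integral (f k) (v k)) ->
  has_integral (fun x => \sum_(m <= k < n) f k x) (\sum_(m <= k < n) v k).
Proof.
move=> fv; have [nm|/ltnW mn] := leqP n m.
  rewrite big_geq//; apply: eq_has_integral has_integral0 => x _.
  by rewrite big_geq.
rewrite -(subnKC mn); elim: (n - m)%N => [|k ih].
  rewrite addn0 big_geq//; apply: eq_has_integral has_integral0 => x _.
  by rewrite big_geq.
rewrite addnS big_nat_recr ?leq_addr//=.
apply: eq_has_integral (has_integralD ih (fv (m + k)%N)) => x _.
by rewrite big_nat_recr ?leq_addr.
Qed.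

Lemma ge0_has_integral f v : measurable_fun D0 f -> (forall x : R, 0 < x -> 0 <= f x) ->
  (\int[mu]_(x in D0) (f x)%:E = v%:E)%E -> has_integral f v.
Proof.
move=> mf f0 fv; split => //; apply/integrableP; split; first exact/measurable_EFinP.
under eq_integral.
  move=> x; rewrite inE/= in_itv/= andbT => x0.
  by rewrite ger0_norm ?f0//; over.
by rewrite fv ltry.
Qed.

Lemma has_integral_le_norm f g w : measurable_fun D0 f ->
  (forall x : R, 0 < x -> `|f x| <= g x) -> has_integral g w ->
  has_integral f (\int[mu]_(x in D0) f x).
Proof.
move=> mf fg [gi gw]; apply: integrable_has_integral.
apply: le_integrable gi => //; first exact/measurable_EFinP.
move=> x; rewrite /= in_itv/= andbT => /fg; rewrite lee_fin => /le_trans; apply.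
exact: ler_norm.
Qed.

Lemma continuous_measurable_D0 f : (forall x : R, 0 < x -> {for x, continuous f}) ->
  measurable_fun D0 f.
Proof.
move=> cf; apply: open_continuous_measurable_fun.
  exact: interval_open.
by move=> x; rewrite inE/= in_itv/= andbT; exact: cf.
Qed.

(** Monotone convergence along growing compact intervals. The endpoints are general sequences
    because the substitution rule below also needs the images of [n.+2%:R^-1] and [n.+2%:R] under a
    change of variables. *)
Lemma cvg_integral_exhaust f (a b : nat -> R) :
  measurable_fun D0 f -> (forall x : R, 0 < x -> 0 <= f x) ->
  (forall n, 0 < a n) -> nonincreasing_seq a -> nondecreasing_seq b ->
  a @ \oo --> 0 -> b @ \oo --> +oo ->
  (\int[mu]_(x in `[a n, b n]) (f x)%:E @[n --> \oo] -->
   \int[mu]_(x in D0) (f x)%:E)%E.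
Proof.
move=> mf f0 a0 na nb ca cb.
have sub n : `[a n, b n]%classic `<=` D0.
  by move=> x /=; rewrite !in_itv/= andbT => /andP[+ _]; exact: lt_le_trans.
have <- : \bigcup_n `[a n, b n]%classic = D0.
  apply/seteqP; split => [x [n _ /sub]//|x /=]; rewrite in_itv/= andbT => x0.
  have H : \forall n \near \oo, a n <= x /\ x <= b n.
    near=> n; split.
      apply: ltW; near: n; exact: (cvgr_lt 0).
    by near: n; move/cvgryPge : cb; apply.
  have [N _ /(_ N (leqnn _))[aN bN]] := H.
  by exists N => //=; rewrite in_itv/= aN bN.
apply: ge0_nondecreasing_set_cvg_integral => //.
- move=> m n mn; apply/subsetPset => x /=; rewrite !in_itv/= => /andP[x1 x2].
  by rewrite (le_trans (na _ _ mn) x1) (le_trans x2 (nb _ _ mn)).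
- move=> n; apply/measurable_EFinP; exact: measurable_funS mf.
- by move=> n x /sub; rewrite /= in_itv/= andbT lee_fin; exact: f0.
Unshelve. all: by end_near. Qed.

(** The half-line is exhausted by the intervals from [1 / (n + 2)] to [n + 2]. The shift by two
    keeps the first of them nondegenerate, as the fundamental theorem of calculus requires. *)
Lemma cvg_invn0 : (n.+2%:R^-1 : R) @[n --> \oo] --> (0 : R).
Proof.
rewrite (_ : (fun n => _) = (fun n => (@harmonic R) n.+1)); last by [].
by rewrite (cvg_shiftS (@harmonic R)); exact: cvg_harmonic.
Qed.

Lemma cvg_natn : (n.+2%:R : R) @[n --> \oo] --> +oo.
Proof.
apply/cvgryPge => M; near=> n.
apply: (@le_trans _ _ n%:R); last by rewrite ler_nat -addn2 leq_addr.
by near: n; exact: nbhs_infty_ger.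
Unshelve. all: by end_near. Qed.

Lemma nonincreasing_invn : nonincreasing_seq (fun n => n.+2%:R^-1 : R).
Proof. by move=> m n mn; rewrite lef_pV2 ?posrE// ler_nat !ltnS. Qed.

Lemma nondecreasing_natn : nondecreasing_seq (fun n => n.+2%:R : R).
Proof. by move=> m n mn; rewrite ler_nat !ltnS. Qed.

Lemma invn_lt_natn n : (n.+2%:R^-1 : R) < n.+2%:R.
Proof. by rewrite (@lt_trans _ _ 1)// ?invf_lt1 ?ltr1n. Qed.

(** For a nonnegative integrand the two limits of [F] already prove integrability. For signed
    integrands [has_integral_primitive] takes integrability as a hypothesis instead. *)
Lemma has_integral_FTC f F (l L : R) :
  (forall x : R, 0 < x -> 0 <= f x) ->
  (forall x : R, 0 < x -> {for x, continuous f}) ->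
  (forall x : R, 0 < x -> is_derive x 1 F (f x)) ->
  F x @[x --> 0^'+] --> l -> F x @[x --> +oo] --> L ->
  has_integral f (L - l).
Proof.
move=> f0 cf dF Fl FL; have mf := continuous_measurable_D0 cf.
apply: ge0_has_integral => //.
have cF x : 0 < x -> {for x, continuous F}.
  by move=> /dF[dFx _]; apply: differentiable_continuous; exact/derivable1_diffP.
have E n : (\int[mu]_(x in `[(n.+2%:R^-1)%R, (n.+2%:R)%R]) (f x)%:E =
    (F n.+2%:R)%:E - (F n.+2%:R^-1)%:E)%E.
  have pos x : x \in `[(n.+2%:R^-1 : R), n.+2%:R] -> 0 < x.
    by rewrite in_itv/= => /andP[+ _]; apply: lt_le_trans; rewrite invr_gt0.
  apply: continuous_FTC2; first exact: invn_lt_natn.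
  - apply: continuous_in_subspaceT => x; rewrite inE/= => /pos; exact: cf.
  - split.
    + by move=> x /subset_itv_oo_cc/pos/dF[].
    + by apply: cvg_at_right_filter; apply: cF; rewrite invr_gt0.
    + by apply: cvg_at_left_filter; exact: cF.
  - move=> x /subset_itv_oo_cc/pos/dF[_ <-]; by rewrite derive1E.
have h1 := @cvg_integral_exhaust f (fun n => n.+2%:R^-1) (fun n => n.+2%:R) mf f0.
have {h1} h1 := h1 (fun n => ltac:(by rewrite invr_gt0)) nonincreasing_invn
  nondecreasing_natn cvg_invn0 cvg_natn.
have h2 : ((F n.+2%:R)%:E - (F n.+2%:R^-1)%:E @[n --> \oo] --> (L - l)%:E)%E.
  rewrite EFinB; apply: cvgeB => //; apply: cvg_EFin; try exact: nearW.
    exact: (cvg_comp _ _ cvg_natn FL).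
  by move/cvg_at_rightP : Fl; apply; split; [move=> n; rewrite invr_gt0|exact: cvg_invn0].
move: h1 => /=; rewrite (funext E) => h1.
exact: (cvg_unique _ h1 h2).
Qed.

Lemma integral_substitution f F F' :
  (forall x : R, 0 < x -> 0 <= f x) ->
  (forall x : R, 0 < x -> {for x, continuous f}) ->
  (forall x : R, 0 < x -> is_derive x 1 F (F' x)) ->
  (forall x : R, 0 < x -> {for x, continuous F'}) ->
  (forall x : R, 0 < x -> 0 < F' x) ->
  (forall x : R, 0 < x -> 0 < F x) ->
  F x @[x --> 0^'+] --> 0 -> F x @[x --> +oo] --> +oo ->
  (\int[mu]_(x in D0) (f x)%:E = \int[mu]_(x in D0) (f (F x) * F' x)%:E)%E.
Proof.
move=> f0 cf dF cF' F'0 F0 Fl FL; have mf := continuous_measurable_D0 cf.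
have cF x : 0 < x -> {for x, continuous F}.
  by move=> /dF[dFx _]; apply: differentiable_continuous; exact/derivable1_diffP.
have incr x y : 0 < x -> x < y -> F x < F y.
  move=> x0 xy.
  have pos z : z \in `[x, y] -> 0 < z.
    by rewrite in_itv/= => /andP[+ _]; exact: lt_le_trans.
  have [z||z zxy] := @MVT R F F' x y xy.
  - by move=> /subset_itv_oo_cc/pos/dF.
  - apply: continuous_in_subspaceT => z; rewrite inE/= => /pos; exact: cF.
  - rewrite -subr_gt0 => ->; rewrite mulr_gt0 ?subr_gt0// F'0//.
    exact/pos/subset_itv_oo_cc.
have mono x y : 0 < x -> x <= y -> F x <= F y.
  by move=> x0; rewrite le_eqVlt => /predU1P[->//|/(incr _ _ x0)/ltW].
have cvF : F (n.+2%:R^-1) @[n --> \oo] --> 0.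
  by move/cvg_at_rightP : Fl; apply; split; [move=> n; rewrite invr_gt0|exact: cvg_invn0].
have cvF' : F n.+2%:R @[n --> \oo] --> +oo by exact: (cvg_comp _ _ cvg_natn FL).
have mfF : measurable_fun D0 (fun x => f (F x) * F' x).
  apply: continuous_measurable_D0 => x x0; apply: cvgM; last exact: cF'.
  apply: (@continuous_comp _ _ _ F f); first exact: cF.
  exact/cf/F0.
have h1 := @cvg_integral_exhaust _ (fun n => F n.+2%:R^-1) (fun n => F n.+2%:R) mf f0.
have {}h1 := h1 (fun n => ltac:(by rewrite F0// invr_gt0)) _ _ cvF cvF'.
have {}h1 : (\int[mu]_(x in `[(F n.+2%:R^-1)%R, (F n.+2%:R)%R]) (f x)%:E @[n --> \oo] -->
   \int[mu]_(x in D0) (f x)%:E)%E.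
  apply: h1.
    by move=> m n mn; rewrite mono ?invr_gt0// nonincreasing_invn.
  by move=> m n mn; rewrite mono// nondecreasing_natn.
have h2 := @cvg_integral_exhaust _ (fun n => n.+2%:R^-1) (fun n => n.+2%:R) mfF
  (fun x x0 => ltac:(by rewrite mulr_ge0 ?f0 ?F0// ltW// F'0)).
have {}h2 := h2 (fun n => ltac:(by rewrite invr_gt0)) nonincreasing_invn
  nondecreasing_natn cvg_invn0 cvg_natn.
have E n : (\int[mu]_(x in `[(F n.+2%:R^-1)%R, (F n.+2%:R)%R]) (f x)%:E =
  \int[mu]_(x in `[(n.+2%:R^-1)%R, (n.+2%:R)%R]) (f (F x) * F' x)%:E)%E.
  have pos x : x \in `[(n.+2%:R^-1 : R), n.+2%:R] -> 0 < x.
    by rewrite in_itv/= => /andP[+ _]; apply: lt_le_trans; rewrite invr_gt0.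
  have F'E (x : R) : 0 < x -> derive1 F x = F' x by move=> /dF[_ <-]; rewrite derive1E.
  have cDF (x : R) : 0 < x -> derive1 F y @[y --> x] --> F' x.
    move=> x0; apply: cvg_trans (cF' _ x0); apply: near_eq_cvg.
    near=> y; rewrite F'E//; near: y; exact: lt_nbhsr.
  rewrite (@integration_by_substitution_increasing _ F)//.
  - apply: eq_integral => x; rewrite inE/= => /pos x0.
    by rewrite /= fctE /= F'E.
  - exact/ltW/invn_lt_natn.
  - by move=> x y /pos x0 _; exact: incr.
  - move=> x /subset_itv_oo_cc/pos x0; rewrite /continuous_at F'E//; exact: cDF.
  - apply/cvg_ex; exists (F' n.+2%:R^-1); apply: cvg_at_right_filter.
    by apply: cDF; rewrite invr_gt0.
  - apply/cvg_ex; exists (F' n.+2%:R); apply: cvg_at_left_filter.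
    exact: cDF.
  - split.
    + by move=> x /subset_itv_oo_cc/pos/dF[].
    + by apply: cvg_at_right_filter; apply: cF; rewrite invr_gt0.
    + by apply: cvg_at_left_filter; exact: cF.
  - apply: continuous_in_subspaceT => x; rewrite inE/= in_itv/= => /andP[x1 _].
    by apply: cf; rewrite (lt_le_trans _ x1)// F0// invr_gt0.
move: h1 h2 => /=; rewrite (funext E) => h1 h2.
exact: (cvg_unique _ h1 h2).
Unshelve. all: by end_near. Qed.

End has_integral.

(** * Dominated termwise integration *)

Section termwise.
Context {R : realType}.
Implicit Types (f g F : R -> R) (v w : R).
Notation mu := (@lebesgue_measure R).
Notation D0 := (`]0, +oo[%classic : set R).

(** The majorant is the sum of the [g k]. It is integrable because nonnegative series can be
    integrated termwise and the integrals [w] are summable. The exceptional set [N] will hold the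
    multiples of [2 pi] when [mu = 1]. *)
Lemma has_integral_dominated (f g : nat -> R -> R) (v w : nat -> R) F (N : set R) :
  countable N -> measurable_fun D0 F ->
  (forall n, has_integral (f n) (v n)) ->
  (forall n, has_integral (g n) (w n)) ->
  (forall n (x : R), 0 < x -> 0 <= g n x) ->
  cvgn (series w) ->
  (forall n (x : R), 0 < x -> (`|f n x|%:E <= \sum_(k <oo) (g k x)%:E)%E) ->
  (forall x : R, 0 < x -> ~ N x -> f ^~ x @ \oo --> F x) ->
  has_integral F (\int[mu]_(x in D0) F x) /\ v @ \oo --> \int[mu]_(x in D0) F x.
Proof.
move=> cN mF fv gw g0 cw fg fF.
have mg n : measurable_fun D0 (EFin \o g n).
  by apply/measurable_EFinP; exact: has_integral_measurable (gw n).
have gD n x : D0 x -> (0 <= (EFin \o g n) x)%E.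
  by rewrite /= in_itv/= andbT lee_fin; exact: g0.
pose G x := (\sum_(k <oo) (EFin \o g k) x)%E.
have G0 x : D0 x -> (0 <= G x)%E.
  by move=> Dx; apply: nneseries_ge0 => n _ _; exact: gD.
have mG : measurable_fun D0 G by apply: (ge0_emeasurable_sum (P := xpredT)) => // n x Dx _; exact: gD.
have w0 n : 0 <= w n.
  rewrite -(has_integral_Rintegral (gw n)).
  by apply: Rintegral_ge0 => x /=; rewrite in_itv/= andbT; exact: g0.
have iG : (\int[mu]_(x in D0) G x < +oo)%E.
  rewrite integral_nneseries//.
  rewrite (eq_eseriesr (g := fun k => (w k)%:E)); last first.
    by move=> k _; have [_ <-] := gw k.
  rewrite (_ : (\sum_(k <oo) (w k)%:E)%E = (limn (series w))%:E) ?ltry//.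
  rewrite -EFin_lim//; congr (limn _); apply/funext => n.
  by rewrite /= /series/= sumEFin.
have intG : mu.-integrable D0 G.
  apply/integrableP; split => //.
  under eq_integral.
    by move=> x; rewrite inE => Dx; rewrite gee0_abs ?G0//; over.
  exact: iG.
have N0 : mu N = 0%E by exact: countable_lebesgue_measure0.
have mN : measurable N by apply: countable_measurable => // t; exact: measurable_set1.
have [] := @dominated_convergence _ _ R mu D0 _ (fun n => EFin \o f n) (EFin \o F) G.
- by [].
- by move=> n; apply/measurable_EFinP; exact: has_integral_measurable (fv n).
- exact/measurable_EFinP.
- exists N; split => // x /= /not_implyP[]; rewrite in_itv/= andbT => x0 H.
  apply: contrapT => Nx; apply: H; apply: cvg_EFin; first exact: nearW.
  exact: fF.
- exact: intG.
- by apply: aeW => x n; rewrite /= in_itv/= andbT => x0; exact: fg.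
move=> iF _ cF.
have hF := integrable_has_integral iF.
split => //.
have : (\int[mu]_(x in D0) (EFin \o f n) x)%E @[n --> \oo] --> (\int[mu]_(x in D0) F x)%:E.
  by rewrite -hF.2.
under eq_fun do rewrite (fv _).2.
by move/fine_cvgP => [].
Qed.

Lemma has_integral_series (f g : nat -> R -> R) (v w : nat -> R) F (N : set R) :
  countable N -> measurable_fun D0 F ->
  (forall n, has_integral (f n) (v n)) ->
  (forall n, has_integral (g n) (w n)) ->
  (forall n (x : R), 0 < x -> `|f n x| <= g n x) ->
  cvgn (series w) ->
  (forall x : R, 0 < x -> ~ N x -> series (f ^~ x) @ \oo --> F x) ->
  has_integral F (\int[mu]_(x in D0) F x) /\ series v @ \oo --> \int[mu]_(x in D0) F x.
Proof.
move=> cN mF fv gw fg cw fF.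
have g0 n (x : R) : 0 < x -> 0 <= g n x by move=> x0; exact: le_trans (fg n _ x0).
apply: (has_integral_dominated (f := fun n x => series (f ^~ x) n) cN mF _ gw) => //.
  by move=> n; rewrite /series/=; exact: has_integral_sum.
move=> n x x0; rewrite /series/=.
apply: (@le_trans _ _ (\sum_(0 <= k < n) (g k x)%:E)%E).
  rewrite sumEFin lee_fin; apply: (le_trans (ler_norm_sum _ _ _)).
  by apply: ler_sum => k _; exact: fg.
apply: nneseries_lim_ge => k _ _; rewrite lee_fin; exact: g0.
Qed.

(** Every subset of a countable set is Borel, so any values of [f] on [N] are harmless. *)
Lemma measurable_fun_countable (N : set R) f : countable N ->
  measurable_fun (D0 `\` N) f -> measurable_fun D0 f.
Proof.
move=> cN mf; have mN : measurable N by apply: countable_measurable => // t; exact: measurable_set1.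
rewrite -(setUIDK D0 N); apply/measurable_funU => //; [exact: measurableI|exact: measurableD|].
split => //= _ Y mY.
apply: countable_measurable => [t|]; first exact: measurable_set1.
apply: sub_countable cN; apply: subset_card_le.
by move=> x [[]].
Qed.

End termwise.

(** * The Gamma function *)

Section Gamma_theory.
Context {R : realType}.
Implicit Types (f g F : R -> R) (v w : R).
Notation mu := (@lebesgue_measure R).
Notation D0 := (`]0, +oo[%classic : set R).

(** A zero integral would force [f] to vanish almost everywhere on a set of infinite measure. *)
Lemma has_integral_gt0 f v : (forall x : R, 0 < x -> 0 < f x) ->
  has_integral f v -> 0 < v.
Proof.
move=> f0 [fi fv].
have v0 : 0 <= v.
  rewrite -lee_fin -fv; apply: integral_ge0 => x; rewrite /= in_itv/= andbT lee_fin.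
  by move=> /f0/ltW.
rewrite lt_neqAle v0 andbT; apply/eqP => v00.
have mf := measurable_int _ fi.
have : (\int[mu]_(x in D0) `|(EFin \o f) x| = 0)%E.
  transitivity (\int[mu]_(x in D0) (f x)%:E)%E; last by rewrite fv -v00.
  apply: eq_integral => x; rewrite inE/= in_itv/= andbT => x0.
  by rewrite ger0_norm// ltW// f0.
move/(ae_eq_integral_abs _ _ mf).1 => [|N [mN N0 sub]]; first by [].
have : (mu D0 <= mu N)%E.
  apply: le_measure; rewrite ?inE//= => x x0; apply: sub => /= /(_ x0) [].
  by apply/eqP; rewrite gt_eqF// f0//; move: x0; rewrite /= in_itv/= andbT.
by rewrite N0 lebesgue_measure_itv/= ltry.
Qed.

(** With integrability given, dominated convergence by [|f|] replaces the monotone convergence of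
    [has_integral_FTC]. *)
Lemma has_integral_primitive f F v (l L : R) :
  has_integral f v ->
  (forall x : R, 0 < x -> {for x, continuous f}) ->
  (forall x : R, 0 < x -> is_derive x 1 F (f x)) ->
  F x @[x --> 0^'+] --> l -> F x @[x --> +oo] --> L ->
  v = L - l.
Proof.
move=> [fi fv] cf dF Fl FL.
have cF x : 0 < x -> {for x, continuous F}.
  by move=> /dF[dFx _]; apply: differentiable_continuous; exact/derivable1_diffP.
pose A n := `[(n.+2%:R^-1 : R)%R, n.+2%:R]%classic.
have mA n : measurable (A n) by exact: measurable_itv.
have E n : (\int[mu]_(x in A n) (f x)%:E =
    (F n.+2%:R)%:E - (F n.+2%:R^-1)%:E)%E.
  have pos x : x \in `[(n.+2%:R^-1 : R), n.+2%:R] -> 0 < x.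
    by rewrite in_itv/= => /andP[+ _]; apply: lt_le_trans; rewrite invr_gt0.
  apply: continuous_FTC2; first exact: invn_lt_natn.
  - apply: continuous_in_subspaceT => x; rewrite inE/= => /pos; exact: cf.
  - split.
    + by move=> x /subset_itv_oo_cc/pos/dF[].
    + by apply: cvg_at_right_filter; apply: cF; rewrite invr_gt0.
    + by apply: cvg_at_left_filter; exact: cF.
  - move=> x /subset_itv_oo_cc/pos/dF[_ <-]; by rewrite derive1E.
have sub n : A n `<=` D0.
  move=> x; rewrite /A/= !in_itv/= andbT => /andP[+ _]; apply: lt_le_trans.
  by rewrite invr_gt0.
have h1 : (\int[mu]_(x in A n) (f x)%:E @[n --> \oo] --> \int[mu]_(x in D0) (f x)%:E)%E.
  have mf := measurable_int _ fi.
  have [] := @dominated_convergence _ _ R mu D0 _ (fun n => (EFin \o f) \_ (A n))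
     (EFin \o f) (abse \o (EFin \o f)).
  - by [].
  - move=> n; apply/measurable_restrict; [exact: mA|by []|].
    by apply: (measurable_funS _ _ mf) => //; exact: subIsetl.
  - exact: mf.
  - apply: aeW => x; rewrite /= in_itv/= andbT => x0.
    apply: cvg_near_cst; near=> n; rewrite patchE mem_set//; rewrite /A/= in_itv/=; apply/andP; split.
      by apply: ltW; near: n; exact: (cvgr_lt 0 cvg_invn0).
    by near: n; move/cvgryPge : (@cvg_natn R); apply.
  - exact: integrable_abse.
  - apply: aeW => x n _; rewrite patchE.
    by case: ifPn => _ /=; rewrite ?lexx ?lee_fin ?normr0 ?normr_ge0.
  move=> _ _; under [X in X @ _ --> _]eq_fun.
    move=> n; rewrite -integral_mkcondr setIidr; last exact: sub.
    over.
  exact.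
have h2 : ((F n.+2%:R)%:E - (F n.+2%:R^-1)%:E @[n --> \oo] --> (L - l)%:E)%E.
  rewrite EFinB; apply: cvgeB => //; apply: cvg_EFin; try exact: nearW.
    exact: (cvg_comp _ _ (@cvg_natn R) FL).
  by move/cvg_at_rightP : Fl; apply; split; [move=> n; rewrite invr_gt0|exact: cvg_invn0].
move: h1; rewrite (funext E) fv => h1.
by apply: EFin_inj; exact: (cvg_unique _ h1 h2).
Unshelve. all: by end_near. Qed.

(** The summand [1] of the constant serves [t <= 1]. For [t > 1] the power is at most [t ^ n] with
    an integer [n > a], and one Taylor term of [expR (e * t)] bounds that. *)
Lemma powR_le_expR (a e : R) : 0 <= a -> 0 < e ->
  exists C, forall t : R, 0 < t -> t `^ a <= C * expR (e * t).
Proof.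
move=> a0 e0; pose n := (Num.truncn a).+1.
have an : a <= n%:R by exact/ltW/Num.Theory.truncnS_gt.
exists (1 + n`!%:R / e ^+ n) => t t0.
rewrite mulrDl mul1r.
have e1 : 1 <= expR (e * t) by rewrite -[leLHS]expR0 ler_expR mulr_ge0// ltW.
have [t1|t1] := leP t 1.
  apply: (@le_trans _ _ 1); last first.
    by rewrite (le_trans e1)// lerDl !mulr_ge0 ?invr_ge0 ?exprn_ge0 ?expR_ge0// ltW.
  have := @ge0_ler_powR R _ a0 t 1; rewrite powR1 !nnegrE => -> //; exact: ltW.
apply: (@le_trans _ _ (t ^+ n)).
  by rewrite -powR_mulrn ?ler_powR// ltW.
rewrite (@le_trans _ _ (n`!%:R / e ^+ n * expR (e * t)))// ?lerDr ?expR_ge0//.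
have H : (e * t) ^+ n / n`!%:R <= expR (e * t).
  have et0 : 0 <= e * t by rewrite mulr_ge0// ltW.
  by apply: le_trans (@expR_ge1Dxn R (e * t) (Num.truncn a) et0); rewrite lerDr.
have -> : t ^+ n = n`!%:R / e ^+ n * ((e * t) ^+ n / n`!%:R).
  rewrite exprMn; field.
  by rewrite ?expf_neq0 ?gt_eqF ?ltr0n ?fact_gt0.
by rewrite ler_wpM2l// divr_ge0// exprn_ge0// ltW.
Qed.

Lemma has_integral_expR (c : R) : 0 < c -> has_integral (fun t => expR (- (c * t))) c^-1.
Proof.
move=> c0.
have := @has_integral_FTC R (fun t => expR (- (c * t))) (fun t => - (c^-1 * expR (- (c * t)))) (- c^-1) 0.
rewrite sub0r opprK; apply.
- by move=> *; exact: expR_ge0.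
- move=> x _; apply: (@continuous_comp _ _ _ (fun t => - (c * t)) expR); last exact: continuous_expR.
  apply: cvgN; apply: cvgM; [exact: cvg_cst|exact: cvg_id].
- move=> x _; apply: is_derive_eq.
  by rewrite /GRing.scale/=; field; exact: lt0r_neq0.
- have -> : - c^-1 = - (c^-1 * expR (- (c * 0))) by rewrite mulr0 oppr0 expR0 mulr1.
  apply: cvgN; apply: cvgMr; apply: cvg_at_right_filter.
  apply: (@continuous_comp _ _ _ (fun t => - (c * t)) expR); last exact: continuous_expR.
  apply: cvgN; apply: cvgM; [exact: cvg_cst|exact: cvg_id].
- have -> : 0 = - (c^-1 * 0) by rewrite mulr0 oppr0.
  apply: cvgN; apply: cvgMr.
  apply: (@cvg_comp _ _ _ (fun t => c * t) (fun t => expR (- t)) _ (pinfty_nbhs R)); last exact: cvgr_expR.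
  exact: gt0_cvgMry.
Qed.

Lemma continuous_powR (a x : R) : 0 < x -> {for x, continuous (fun t => t `^ a)}.
Proof.
move=> x0; apply: differentiable_continuous; apply/derivable1_diffP.
by have [] := @is_derive1_powR R a x x0.
Qed.

Lemma measurable_powR_expR (a c : R) : measurable_fun D0 (fun t => t `^ a * expR (- (c * t))).
Proof.
apply: measurable_funM; first by apply: measurable_funTS; exact: measurable_powR.
apply: measurableT_comp => //; apply: measurable_funN.
exact: mulrl_measurable.
Qed.

Lemma has_integral_powR_expR (a c : R) : 0 <= a -> 0 < c ->
  has_integral (fun t => t `^ a * expR (- (c * t)))
    (\int[mu]_(t in D0) (t `^ a * expR (- (c * t)))).
Proof.
(* Half of the exponential absorbs the power, the other half stays integrable. *)
move=> a0 c0; have c20 : 0 < c / 2 by rewrite divr_gt0.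
have [C HC] := powR_le_expR a0 c20.
apply: (has_integral_le_norm _ _ (has_integralZ C (has_integral_expR c20))).
  exact: measurable_powR_expR.
move=> x x0; rewrite ger0_norm ?mulr_ge0 ?powR_ge0 ?expR_ge0//.
apply: (le_trans (ler_wpM2r (expR_ge0 _) (HC x x0))).
by rewrite -[leLHS]mulrA -expRD (_ : _ + _ = - (c / 2 * x))//; field.
Qed.

Lemma has_integral_Gamma (a : R) : 1 <= a ->
  has_integral (fun t => t `^ (a - 1) * expR (- t)) (Gamma a).
Proof.
move=> a1; have := @has_integral_powR_expR (a - 1) 1.
rewrite subr_ge0 => /(_ a1 ltr01).
rewrite /Gamma; under [X in has_integral X]eq_fun do rewrite mul1r.
by under [X in has_integral _ X -> _]eq_Rintegral do rewrite mul1r.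
Qed.

Lemma Gamma_gt0 (a : R) : 1 <= a -> 0 < Gamma a.
Proof.
move=> /has_integral_Gamma; apply: has_integral_gt0 => x x0.
by rewrite mulr_gt0 ?powR_gt0 ?expR_gt0.
Qed.

Lemma cvg_powR_expR0 (a c : R) : 0 < a -> 0 < c ->
  x `^ a * expR (- (c * x)) @[x --> 0^'+] --> 0.
Proof.
move=> a0 c0; apply: (squeeze_cvgr _ (cvg_cst 0) (powR_cvg0 a0)).
near=> x; rewrite mulr_ge0 ?powR_ge0 ?expR_ge0//= ler_piMr ?powR_ge0//.
by rewrite expR_le1 oppr_le0 mulr_ge0// ltW.
Unshelve. all: by end_near. Qed.

Lemma cvg_powR_expRy (a c : R) : 0 <= a -> 0 < c ->
  x `^ a * expR (- (c * x)) @[x --> +oo] --> 0.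
Proof.
move=> a0 c0; have c20 : 0 < c / 2 by rewrite divr_gt0.
have [C HC] := powR_le_expR a0 c20.
apply: (@squeeze_cvgr _ _ _ _ (fun=> 0) (fun x => C * expR (- (c / 2 * x)))); last 2 first.
- exact: cvg_cst.
- have -> : 0 = C * 0 by rewrite mulr0.
  apply: cvgMr.
  apply: (@cvg_comp _ _ _ (fun t => c / 2 * t) (fun t => expR (- t)) _ (pinfty_nbhs R)); last exact: cvgr_expR.
  exact: gt0_cvgMry.
near=> x; have x0 : 0 < x by near: x; exact: nbhs_pinfty_gt.
rewrite mulr_ge0 ?powR_ge0 ?expR_ge0//=.
apply: (le_trans (ler_wpM2r (expR_ge0 _) (HC x x0))).
by rewrite -[leLHS]mulrA -expRD (_ : _ + _ = - (c / 2 * x))//; field.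
Unshelve. all: by end_near. Qed.

Lemma continuous_powR_expRN (a x : R) : 0 < x ->
  {for x, continuous (fun t => t `^ a * expR (- t))}.
Proof.
move=> x0; apply: cvgM; first exact: continuous_powR.
apply: (@continuous_comp _ _ _ (fun t : R => - t) expR); last exact: continuous_expR.
by apply: cvgN; exact: cvg_id.
Qed.

(** The derivative of [t ^ a exp (- t)], which vanishes at both ends, is the difference of the two
    integrands. *)
Lemma GammaS (a : R) : 1 <= a -> Gamma (a + 1) = a * Gamma a.
Proof.
move=> a1; have a0 : 0 < a by rewrite (lt_le_trans _ a1).
have h1 := has_integral_Gamma a1.
have a2 : 1 <= a + 1 by rewrite lerDr ltW.
have := has_integral_Gamma a2; rewrite addrK => h2.
have h3 := has_integralB (has_integralZ a h1) h2.
apply/esym/eqP; rewrite -subr_eq0; apply/eqP.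
rewrite -[RHS](subrr 0); apply: (has_integral_primitive (F := fun t => t `^ a * expR (- (1 * t))) h3).
- move=> x x0; apply: cvgB.
    apply: cvgM; first exact: cvg_cst.
    exact: continuous_powR_expRN.
  exact: continuous_powR_expRN.
- move=> x x0; have ? := is_derive1_powR a x0.
  by apply: is_derive_eq; rewrite /GRing.scale/= !mul1r; ring.
- exact: cvg_powR_expR0.
- by apply: cvg_powR_expRy => //; exact: ltW.
Qed.

Lemma Gamma1 : Gamma 1 = 1 :> R.
Proof.
apply: (has_integral_unique (has_integral_Gamma (lexx 1))).
have := has_integral_expR (@ltr01 R); rewrite invr1; apply: eq_has_integral => x _.
by rewrite subrr powRr0 !mul1r.
Qed.

(** Euler's integral after the substitution of [p t ^ 2] for the variable. *)
Lemma has_integral_gauss_moment (a p : R) : 1 <= a -> 0 < p ->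
  has_integral (fun t => t `^ (2 * a - 1) * expR (- (p * t ^+ 2))) (Gamma a / (2 * p `^ a)).
Proof.
move=> a1 p0.
have pa0 : 0 < p `^ a by exact: powR_gt0.
have H : has_integral (fun t => 2 * p `^ a * (t `^ (2 * a - 1) * expR (- (p * t ^+ 2)))) (Gamma a).
  have [_ h] := has_integral_Gamma a1.
  apply: ge0_has_integral.
  - apply: measurable_funM => //; apply: measurable_funM.
      by apply: measurable_funTS; exact: measurable_powR.
    apply: measurableT_comp => //; apply: measurable_funN.
    apply: measurable_funM => //; exact: exprn_measurable.
  - move=> x x0; rewrite !mulr_ge0 ?powR_ge0 ?expR_ge0//.
  pose f t := t `^ (a - 1) * expR (- t).
  pose F t := p * t ^+ 2; pose F' t := 2 * p * t.
  transitivity (\int[mu]_(x in D0) (f (F x) * F' x)%:E)%E; last first.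
    rewrite -h; apply/esym/integral_substitution; rewrite /f /F /F'.
  - by move=> x x0; rewrite mulr_ge0 ?powR_ge0 ?expR_ge0.
  - by move=> x x0; exact: continuous_powR_expRN.
  - move=> x x0; apply: is_derive_eq; rewrite /GRing.scale/= ?expr1; ring.
  - move=> x x0; apply: cvgM; [exact: cvg_cst|exact: cvg_id].
  - by move=> x x0; rewrite !mulr_gt0.
  - by move=> x x0; rewrite mulr_gt0 ?exprn_gt0.
  - have : p * x ^+ 2 @[x --> 0^'+] --> p * 0 ^+ 2.
      apply: cvg_at_right_filter; apply: cvgM; [exact: cvg_cst|exact: exprn_continuous].
    by rewrite expr0n mulr0.
  - apply: gt0_cvgMry => //; apply/cvgryPge => M; near=> x.
    have x1 : 1 <= x by near: x; exact: nbhs_pinfty_ge.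
    have xM : M <= x by near: x; exact: nbhs_pinfty_ge.
    by rewrite (le_trans xM)// expr2 ler_peMr// (le_trans ler01).
  apply: eq_integral => x; rewrite inE/= in_itv/= andbT => x0; congr EFin; rewrite /f /F /F'.
    rewrite powRM ?sqr_ge0 ?ltW// -powR_mulrn ?ltW// -powRrM.
    rewrite (_ : 2 * a - 1 = 2 * (a - 1) + 1); last by ring.
    rewrite (@powRD _ x (2 * (a - 1)) 1) ?(gt_eqF x0) ?implybT// powRr1 ?ltW//.
    rewrite -(mulr_powRB1 (ltW p0) (lt_le_trans ltr01 a1)).
    by ring.
rewrite [X in has_integral _ X]mulrC.
apply: eq_has_integral (has_integralZ (2 * p `^ a)^-1 H) => x x0.
by rewrite mulKf// mulf_neq0// gt_eqF.
Unshelve. all: by end_near. Qed.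

End Gamma_theory.

Local Opaque Gamma.

(** * Bessel functions *)

Section Bessel.
Context {R : realType}.
Implicit Types (nu x y : R).

Definition bessel_coef nu (m : nat) : R := (-1) ^+ m / (m`!%:R * Gamma (m%:R + nu + 1)).

(* [BesselJ nu x = (x / 2) `^ nu * bessel_pseries nu ((x / 2) ^+ 2)] for [0 < x]. *)
Definition bessel_pseries nu y : R := limn (pseries (bessel_coef nu) y).

(** Gamma is not monotone between 1 and 2, but integer shifts multiply it by factors at least 1. The
    Bessel series is thereby dominated by an exponential series. *)
Lemma le_Gamma_natD nu (m : nat) : 0 <= nu -> Gamma (nu + 1) <= Gamma (m%:R + nu + 1).
Proof.
move=> nu0; elim: m => [|m /le_trans]; first by rewrite add0r.
apply; have g1 : 1 <= m%:R + nu + 1 by rewrite lerDr addr_ge0.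
rewrite (_ : m.+1%:R + nu + 1 = m%:R + nu + 1 + 1); last by rewrite -natr1; ring.
by rewrite (@GammaS _ (m%:R + nu + 1))// ler_peMl//; exact/ltW/Gamma_gt0.
Qed.

Lemma norm_bessel_coef nu y (m : nat) : 0 <= nu ->
  `|bessel_coef nu m * y ^+ m| <= (Gamma (nu + 1))^-1 * exp_coeff `|y| m.
Proof.
move=> nu0; have G0 : 0 < Gamma (nu + 1) by apply: Gamma_gt0; rewrite lerDr.
have Gm0 : 0 < Gamma (m%:R + nu + 1) by apply: Gamma_gt0; rewrite lerDr addr_ge0.
rewrite /bessel_coef /exp_coeff/= !normrM normrX normrN1 expr1n mul1r normrX.
rewrite ger0_norm; last by rewrite invr_ge0 (mulr_ge0 (ler0n _ _) (ltW Gm0)).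
have -> : (m`!%:R * Gamma (m%:R + nu + 1))^-1 * `|y| ^+ m =
    (Gamma (m%:R + nu + 1))^-1 * (`|y| ^+ m / m`!%:R).
  by rewrite invfM mulrC mulrA mulrC.
apply: ler_wpM2r; first exact: divr_ge0 (exprn_ge0 _ (normr_ge0 _)) (ler0n _ _).
by rewrite (lef_pV2 Gm0 G0); exact: le_Gamma_natD.
Qed.

Lemma is_cvg_bessel_abs nu y : 0 <= nu ->
  cvgn (series (fun m => `|bessel_coef nu m * y ^+ m|)).
Proof.
move=> nu0; apply: (@series_le_cvg _ _ (fun m => (Gamma (nu + 1))^-1 * exp_coeff `|y| m)).
- by move=> n; rewrite normr_ge0.
- move=> n; apply: le_trans (norm_bessel_coef y n nu0); exact: normr_ge0.
- by move=> n; exact: norm_bessel_coef.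
- by apply: is_cvg_seriesZ; exact: is_cvg_series_exp_coeff.
Qed.

Lemma is_cvg_bessel_pseries nu y : 0 <= nu -> cvgn (pseries (bessel_coef nu) y).
Proof. by move=> nu0; apply: normed_cvg; exact: is_cvg_bessel_abs. Qed.

Lemma norm_bessel_pseries nu y : 0 <= nu ->
  `|bessel_pseries nu y| <= (Gamma (nu + 1))^-1 * expR `|y|.
Proof.
move=> nu0; rewrite /bessel_pseries /pseries.
have H := @lim_series_norm R R (fun m => bessel_coef nu m * y ^+ m) (@is_cvg_bessel_abs nu y nu0).
apply: (le_trans H).
have -> : (Gamma (nu + 1))^-1 * expR `|y| =
    limn (series (fun m => (Gamma (nu + 1))^-1 * exp_coeff `|y| m)).
  by rewrite lim_seriesZ//; exact: is_cvg_series_exp_coeff.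
apply: lim_series_le; first exact: is_cvg_bessel_abs.
  by apply: is_cvg_seriesZ; exact: is_cvg_series_exp_coeff.
by move=> n; exact: norm_bessel_coef.
Qed.

Lemma pseries_diffs_bessel nu :
  pseries_diffs (bessel_coef nu) = - bessel_coef (nu + 1).
Proof.
apply/funext => m; rewrite /pseries_diffs /bessel_coef fctE.
have -> : m.+1%:R + nu + 1 = m%:R + (nu + 1) + 1.
  by rewrite -natr1; ring.
rewrite factS natrM exprS -mulrA mulN1r !invfM.
have m0 : m.+1%:R != 0 :> R by rewrite pnatr_eq0.
set G := (Gamma _)^-1; set k := (m`!%:R)^-1; set s := (-1) ^+ m.
by field.
Qed.

Lemma pseriesN (c : nat -> R) y : pseries (- c) y = - pseries c y.
Proof.
apply/funext => n; transitivity (- (\sum_(0 <= k < n) c k * y ^+ k)); last by [].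
by rewrite -sumrN; apply: eq_bigr => i _; rewrite -mulNr.
Qed.

Lemma is_derive_bessel_pseries nu y : 0 <= nu ->
  is_derive y 1 (bessel_pseries nu) (- bessel_pseries (nu + 1) y).
Proof.
move=> nu0; have nu1 : 0 <= nu + 1 by rewrite addr_ge0.
have nu2 : 0 <= nu + 1 + 1 by rewrite addr_ge0.
have K1 : `|y| < `|(`|y| + 1)|.
  by rewrite [ltRHS]ger0_norm ?addr_ge0// ltrDl.
have := @pseries_snd_diffs R (bessel_coef nu) (`|y| + 1) y.
rewrite pseries_diffs_bessel pseries_diffsN pseries_diffs_bessel opprK => /(_ _ _ _ K1).
move=> /(_ (@is_cvg_bessel_pseries _ _ nu0)).
rewrite !pseriesN [limn (- pseries _ y)]limN; last exact: is_cvg_bessel_pseries.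
move=> H; rewrite /bessel_pseries; apply: H.
  by apply: is_cvgN; exact: is_cvg_bessel_pseries.
exact: is_cvg_bessel_pseries.
Qed.

(** The factor [y] in front of the series of [d] raises its powers by one, hence [n] terms there
    against [n.+1] elsewhere. *)
Lemma pseries_rec (b c d : nat -> R) (k y : R) n : b 0%N = k * c 0%N ->
  (forall m, b m.+1 = k * c m.+1 - d m) ->
  pseries b y n.+1 = k * pseries c y n.+1 - y * pseries d y n.
Proof.
move=> b0 bS; rewrite /pseries /series/=; elim: n => [|n ih].
  by rewrite !big_nat1 (@big_geq _ _ _ 0 0)// mulr0 subr0 b0 mulrA.
rewrite big_nat_recr//= ih [in RHS]big_nat_recr//= [X in _ = _ - y * X]big_nat_recr//=.
by rewrite bS exprS; ring.
Qed.

(** By [GammaS], the coefficient of order [nu] is [m + (nu + 1)] times that of order [nu + 1]. The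
    part with [m] is a differentiated series, which [pseries_diffs_bessel] turns into order
    [nu + 2]. *)
Lemma bessel_pseries_rec nu y : 0 <= nu ->
  bessel_pseries nu y =
  (nu + 1) * bessel_pseries (nu + 1) y - y * bessel_pseries (nu + 2) y.
Proof.
move=> nu0; have nu1 : 0 <= nu + 1 by rewrite addr_ge0.
have nu2 : 0 <= nu + 2 by rewrite addr_ge0.
have E n : pseries (bessel_coef nu) y n.+1 = (nu + 1) * pseries (bessel_coef (nu + 1)) y n.+1
    - y * pseries (bessel_coef (nu + 2)) y n.
  have G (m : nat) : bessel_coef nu m = (m%:R + nu + 1) * bessel_coef (nu + 1) m.
    rewrite /bessel_coef (_ : m%:R + (nu + 1) + 1 = m%:R + nu + 1 + 1); last by ring.
    rewrite (@GammaS _ (m%:R + nu + 1)) ?lerDr ?addr_ge0//.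
    have g0 : Gamma (m%:R + nu + 1) != 0.
      by rewrite gt_eqF// Gamma_gt0// lerDr addr_ge0.
    have m0 : m`!%:R != 0 :> R by rewrite pnatr_eq0 -lt0n fact_gt0.
    have n0 : m%:R + nu + 1 != 0 by rewrite gt_eqF// ltr_wpDl ?addr_ge0.
    by field; rewrite g0 m0 n0.
  apply: pseries_rec => [|m]; first by rewrite G add0r.
  have := congr1 (fun f => f m) (pseries_diffs_bessel (nu + 1)).
  rewrite /pseries_diffs fctE (_ : nu + 1 + 1 = nu + 2); last by ring.
  rewrite (G m.+1); move: (bessel_coef (nu + 1) m.+1) (bessel_coef (nu + 2) m) => u v h.
  by rewrite -[v]opprK -[- v]h; ring.
have c1 : pseries (bessel_coef nu) y n.+1 @[n --> \oo] --> bessel_pseries nu y.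
  rewrite (cvg_shiftS (pseries (bessel_coef nu) y)); exact: is_cvg_bessel_pseries.
have c2 : (nu + 1) * pseries (bessel_coef (nu + 1)) y n.+1
    - y * pseries (bessel_coef (nu + 2)) y n @[n --> \oo] -->
  (nu + 1) * bessel_pseries (nu + 1) y - y * bessel_pseries (nu + 2) y.
  apply: cvgB; apply: cvgMr; last exact: is_cvg_bessel_pseries.
  by rewrite (cvg_shiftS (pseries (bessel_coef (nu + 1)) y)); exact: is_cvg_bessel_pseries.
move: c1; rewrite (funext E) => c1; exact: (cvg_unique _ c1 c2).
Qed.

Lemma bessel_term nu x (m : nat) : 0 < x ->
  (-1) ^+ m / (m`!%:R * Gamma (m%:R + nu + 1)) * (x / 2) `^ (2 * m%:R + nu) =
  (x / 2) `^ nu * (bessel_coef nu m * ((x / 2) ^+ 2) ^+ m).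
Proof.
move=> x0; have x20 : 0 < x / 2 by rewrite divr_gt0.
rewrite powRD ?(gt_eqF x20) ?implybT// powRrM !powR_mulrn ?powR_ge0 ?exprn_ge0 ?ltW//.
rewrite /bessel_coef; set c := (_ / _); ring.
Qed.

Lemma cvg_BesselJ nu x : 0 <= nu -> 0 < x ->
  \sum_(0 <= m < n) ((-1) ^+ m / (m`!%:R * Gamma (m%:R + nu + 1))
      * (x / 2) `^ (2 * m%:R + nu)) @[n --> \oo] -->
  (x / 2) `^ nu * bessel_pseries nu ((x / 2) ^+ 2).
Proof.
move=> nu0 x0; under eq_fun do under eq_bigr do rewrite bessel_term//.
under eq_fun do rewrite -mulr_sumr.
apply: cvgMr; exact: is_cvg_bessel_pseries.
Qed.

Lemma BesselJE nu x : 0 <= nu -> 0 < x ->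
  BesselJ nu x = (x / 2) `^ nu * bessel_pseries nu ((x / 2) ^+ 2).
Proof. by move=> nu0 x0; apply/cvg_lim => //; exact: cvg_BesselJ. Qed.

Lemma is_derive_BesselJ_pseries nu x : 0 <= nu -> 0 < x ->
  is_derive x 1 (fun t => (t / 2) `^ nu * bessel_pseries nu ((t / 2) ^+ 2))
    (nu / x * BesselJ nu x - BesselJ (nu + 1) x).
Proof.
move=> nu0 x0; have x20 : 0 < x / 2 by rewrite divr_gt0.
have nu1 : 0 <= nu + 1 by rewrite addr_ge0.
have d1 : is_derive x 1 (fun t => t / 2) 2^-1.
  by apply: is_derive_eq; rewrite /GRing.scale/=; ring.
have d2 : is_derive x 1 (fun t => (t / 2) `^ nu) (2^-1 * (nu * (x / 2) `^ (nu - 1))).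
  have := @is_derive1_comp R (fun t => t `^ nu) (fun t => t / 2) x _ _ (is_derive1_powR nu x20) d1.
  by rewrite mulrC.
have d3 : is_derive x 1 (fun t : R => (t / 2) ^+ 2) (x / 2).
  by apply: is_derive_eq; rewrite /GRing.scale/=; field.
have d4 : is_derive x 1 (fun t => bessel_pseries nu ((t / 2) ^+ 2))
    (x / 2 * - bessel_pseries (nu + 1) ((x / 2) ^+ 2)).
  have := @is_derive1_comp R (bessel_pseries nu) (fun t => (t / 2) ^+ 2) x _ _
    (is_derive_bessel_pseries _ nu0) d3.
  by rewrite mulrC.
apply: is_derive_eq; rewrite /GRing.scale/= !BesselJE//.
rewrite powRB ?(gt_eqF x20) ?implybT// powRD ?(gt_eqF x20) ?implybT// !powRr1 ?(ltW x20)//.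
move: (bessel_pseries nu _) (bessel_pseries (nu + 1) _) ((x / 2) `^ nu) => b0 b1 p.
by field; rewrite gt_eqF.
Qed.

Lemma is_derive_BesselJ nu x : 0 <= nu -> 0 < x ->
  is_derive x 1 (BesselJ nu) (nu / x * BesselJ nu x - BesselJ (nu + 1) x).
Proof.
move=> nu0 x0; apply: near_eq_is_derive (is_derive_BesselJ_pseries nu0 x0).
near=> t; rewrite BesselJE//; near: t; exact: lt_nbhsr.
Unshelve. all: by end_near. Qed.

Lemma BesselJ_rec nu x : 0 <= nu -> 0 < x ->
  BesselJ nu x = 2 * (nu + 1) / x * BesselJ (nu + 1) x - BesselJ (nu + 2) x.
Proof.
move=> nu0 x0; have x20 : 0 < x / 2 by rewrite divr_gt0.
rewrite !BesselJE ?addr_ge0// (bessel_pseries_rec _ nu0).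
rewrite (@powRD _ _ nu 1) ?(@powRD _ _ nu 2) ?(gt_eqF x20) ?implybT//.
rewrite powRr1 ?powR_mulrn ?(ltW x20)//.
move: (bessel_pseries (nu + 1) _) (bessel_pseries (nu + 2) _) ((x / 2) `^ nu) => b0 b1 p.
by field; rewrite gt_eqF.
Qed.

Lemma is_derive_BesselJS nu x : 0 <= nu -> 0 < x ->
  is_derive x 1 (BesselJ (nu + 1)) (BesselJ nu x - (nu + 1) / x * BesselJ (nu + 1) x).
Proof.
move=> nu0 x0; have nu1 : 0 <= nu + 1 by rewrite addr_ge0.
have ? := is_derive_BesselJ nu1 x0.
apply: is_derive_eq; rewrite (BesselJ_rec nu0 x0) -addrA (_ : 1 + 1 = 2)//.
move: (BesselJ (nu + 1) x) (BesselJ (nu + 2) x) => b0 b1.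
by field; rewrite gt_eqF.
Qed.

End Bessel.

Local Opaque BesselJ.

(** * Decay of Bessel functions at infinity *)

Section Bessel_decay.
Context {R : realType}.
Implicit Types (nu x y : R).

(* With [a := 2 nu + 1], the energy [E := x (J ^ 2 + J1 ^ 2) - a J J1] satisfies
   [E' = a / x * J J1 <= a / x ^ 2 * E] for [a <= x]: the cross term cancels the
   part of the derivative that is not integrable. *)
Lemma BesselJ_decay nu : 0 <= nu ->
  exists C, forall x, 0 < x -> `|BesselJ nu x| <= C * x `^ (- 2^-1).
Proof.
move=> nu0; pose a : R := 2 * nu + 1.
have a0 : 0 < a by rewrite ltr_wpDl ?mulr_ge0.
pose J := @BesselJ R nu; pose J1 := @BesselJ R (nu + 1).
pose E x := x * (J x ^+ 2 + J1 x ^+ 2) - a * (J x * J1 x).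
(* [expR (a / x)] is the integrating factor of [E' <= a / x ^ 2 * E], so [W] is nonincreasing from
   [a] on. *)
pose W x := E x * expR (a / x).
have dE x : 0 < x -> is_derive x 1 E (a / x * (J x * J1 x)).
  move=> x0; have ? := is_derive_BesselJ nu0 x0; have ? := is_derive_BesselJS nu0 x0.
  rewrite /E; apply: is_derive_eq; rewrite /GRing.scale/= -/J -/J1.
  by rewrite /a; move: (J x) (J1 x) => u v; field; rewrite gt_eqF.
have dX x : 0 < x -> is_derive x 1 (fun t => expR (a / t)) (- (a / x ^+ 2) * expR (a / x)).
  move=> x0; have ? : is_derive x 1 (fun t : R => t^-1) (- x ^- 2).
    apply: is_derive_eq; first by apply: is_deriveV; rewrite gt_eqF.
    by rewrite /GRing.scale/= mulr1.
  by apply: is_derive_eq; rewrite /GRing.scale/=; field; rewrite gt_eqF.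
have dW x : 0 < x -> is_derive x 1 W ((a / x * (J x * J1 x) - a / x ^+ 2 * E x) * expR (a / x)).
  move=> x0; have ? := dE _ x0; have ? := dX _ x0.
  by rewrite /W; apply: is_derive_eq; rewrite /GRing.scale/=; move: (J x * J1 x) (E x) (expR _) => u v w; ring.
have Ege x : a <= x -> x / 2 * (J x ^+ 2 + J1 x ^+ 2) <= E x.
  move=> ax; have x0 : 0 < x by exact: lt_le_trans ax.
  rewrite /E -subr_ge0.
  have -> : x * (J x ^+ 2 + J1 x ^+ 2) - a * (J x * J1 x) - x / 2 * (J x ^+ 2 + J1 x ^+ 2) =
     (x - a) / 2 * (J x ^+ 2 + J1 x ^+ 2) + a / 2 * (J x - J1 x) ^+ 2.
    by move: (J x) (J1 x) => u v; field.
  rewrite addr_ge0// mulr_ge0 ?addr_ge0 ?sqr_ge0// divr_ge0 ?subr_ge0// ltW//.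
have W'le0 x : a <= x -> (a / x * (J x * J1 x) - a / x ^+ 2 * E x) * expR (a / x) <= 0.
  move=> ax; have x0 : 0 < x by exact: lt_le_trans ax.
  rewrite pmulr_lle0 ?expR_gt0// subr_le0.
  apply: (@le_trans _ _ (a / x ^+ 2 * (x / 2 * (J x ^+ 2 + J1 x ^+ 2)))); last first.
    by rewrite ler_wpM2l ?Ege// divr_ge0 ?exprn_ge0// ltW.
  rewrite -subr_ge0.
  have -> : a / x ^+ 2 * (x / 2 * (J x ^+ 2 + J1 x ^+ 2)) - a / x * (J x * J1 x) =
    a / x / 2 * (J x - J1 x) ^+ 2.
    by move: (J x) (J1 x) => u v; field; rewrite gt_eqF.
  by rewrite mulr_ge0 ?sqr_ge0// !divr_ge0// ltW.
have Wle x : a <= x -> W x <= W a.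
  rewrite le_eqVlt => /predU1P[->//|ax].
  have pos z : z \in `[a, x] -> a <= z /\ 0 < z.
    by rewrite in_itv/= => /andP[az _]; split => //; exact: lt_le_trans az.
  have [||c /subset_itv_oo_cc/pos[ac c0]] :=
      @MVT R W (fun x => (a / x * (J x * J1 x) - a / x ^+ 2 * E x) * expR (a / x)) a x ax.
  - by move=> z /subset_itv_oo_cc/pos[_ /dW].
  - apply: derivable_within_continuous => z /pos[_ /dW[]//].
  - by move=> H; rewrite -subr_le0 H mulr_le0_ge0 ?W'le0// subr_ge0 ltW.
have Wge0 : 0 <= W a.
  rewrite mulr_ge0 ?expR_ge0// (le_trans _ (Ege a _))//.
  by rewrite mulr_ge0 ?addr_ge0 ?sqr_ge0// divr_ge0// ltW.
(* A bound of [|J|] on the interval up to [a], read off the power series. *)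
pose M2 := (a / 2) `^ nu * ((Gamma (nu + 1))^-1 * expR ((a / 2) ^+ 2)).
have M20 : 0 <= M2.
  rewrite !mulr_ge0 ?powR_ge0 ?expR_ge0// invr_ge0 ltW// Gamma_gt0// lerDr//.
(* Beyond [a] the chain [x / 2 * J ^ 2 <= E <= W <= W a] gives the first summand. Below [a] one has
   [1 <= (a / x) ^ (1/2)], which gives the second. *)
exists (Num.sqrt (2 * W a) + M2 * a `^ 2^-1) => x x0.
have xp : 0 < x `^ (- 2^-1) by exact: powR_gt0.
rewrite mulrDl; have [xa|ax] := leP x a.
  apply: (@le_trans _ _ M2); last first.
    apply: (@le_trans _ _ (M2 * a `^ 2^-1 * x `^ (- 2^-1))); last first.
      by rewrite lerDr mulr_ge0 ?sqrtr_ge0// ltW.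
    rewrite -mulrA ler_peMr// powRN ler_pdivlMr ?powR_gt0// mul1r.
    by rewrite ge0_ler_powR ?nnegrE ?invr_ge0// ltW.
  have x20 : 0 < x / 2 by rewrite divr_gt0.
  have xa2 : x / 2 <= a / 2 by rewrite ler_pM2r.
  rewrite BesselJE// normrM ger0_norm ?powR_ge0// ler_pM ?powR_ge0//.
    by rewrite ge0_ler_powR ?nnegrE// ltW// (lt_le_trans x20).
  apply: (le_trans (norm_bessel_pseries _ nu0)).
  rewrite ler_wpM2l//; first by rewrite invr_ge0 ltW// Gamma_gt0// lerDr.
  rewrite ler_expR ger0_norm ?sqr_ge0// ler_sqr ?nnegrE//; first exact: ltW.
  by rewrite (le_trans _ xa2)// ltW.
apply: (@le_trans _ _ (Num.sqrt (2 * W a) * x `^ (- 2^-1))); last first.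
  rewrite lerDl; exact: mulr_ge0 (mulr_ge0 M20 (powR_ge0 _ _)) (powR_ge0 _ _).
rewrite powRN powR12_sqrt ?(ltW x0)// -sqrtr_sqr.
rewrite ler_pdivlMr ?sqrtr_gt0// -sqrtrM ?sqr_ge0// ler_wsqrtr//.
have Ex := Ege x (ltW ax).
have EW : E x <= W x.
  rewrite /W ler_peMr//.
    by rewrite (le_trans _ Ex)// mulr_ge0 ?addr_ge0 ?sqr_ge0// divr_ge0// ltW.
  by rewrite -expR0 ler_expR divr_ge0// ltW.
have Wx := Wle x (ltW ax).
have H : x / 2 * J x ^+ 2 <= W a.
  apply: le_trans (le_trans Ex (le_trans EW Wx)).
  by rewrite ler_wpM2l ?lerDl ?sqr_ge0// divr_ge0// ltW.
move: H; rewrite -/(J x); move: (J x ^+ 2) (W a) => u v; lra.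
Qed.

End Bessel_decay.

(** * The elementary Bessel function of order 3/2 *)

Section Bessel_three_halves.
Context {R : realType}.
Notation mu := (@lebesgue_measure R).
Notation D0 := (`]0, +oo[%classic : set R).

Lemma has_integral_gauss : has_integral (fun t : R => expR (- (1 * t ^+ 2))) (Num.sqrt pi / 2).
Proof.
apply: ge0_has_integral.
- apply: measurable_funTS; have := @measurable_gauss_fun R.
  by rewrite /gauss_fun; under [X in _ -> measurable_fun _ X]eq_fun do rewrite mul1r.
- by move=> *; exact: expR_ge0.
- rewrite integral_itv_obnd_cbnd.
    by rewrite -integral0y_gauss; apply: eq_integral => x _; rewrite mul1r.
  apply/measurable_EFinP; apply: measurable_funTS; have := @measurable_gauss_fun R.
  by rewrite /gauss_fun; under [X in _ -> measurable_fun _ X]eq_fun do rewrite mul1r.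
Qed.

(** The function [- t exp (- t ^ 2)] vanishes at both ends, and its derivative
    [(2 t ^ 2 - 1) exp (- t ^ 2)] ties the second Gaussian moment to the Gaussian integral. This
    avoids the argument 1/2, which lies outside the range of [GammaS]. *)
Lemma Gamma32 : Gamma (3 / 2) = Num.sqrt pi / 2 :> R.
Proof.
have a1 : 1 <= 3 / 2 :> R by lra.
have h1 := has_integral_gauss_moment a1 ltr01.
rewrite powR1 mulr1 in h1.
have h2 := has_integral_gauss.
have h3 := has_integralB (has_integralZ 2 h1) h2.
have h4 : has_integral (fun t : R => (2 * t ^+ 2 - 1) * expR (- (1 * t ^+ 2)))
    (2 * (Gamma (3 / 2) / 2) - Num.sqrt pi / 2).
  apply: eq_has_integral h3 => x x0.
  have -> : 2 * (3 / 2) - 1 = 2%:R :> R by lra.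
  by rewrite powR_mulrn ?ltW//; ring.
suff : 2 * (Gamma (3 / 2) / 2) - Num.sqrt pi / 2 = 0 - 0 :> R.
  move=> e; apply/eqP; rewrite -subr_eq0 -[X in _ == X](subr0 0) -e; apply/eqP.
  by move: (Gamma _) (Num.sqrt _) => u v; field.
have c2 (x : R) : {for x, continuous (fun t : R => expR (- (1 * t ^+ 2)))}.
  apply: (@continuous_comp _ _ _ (fun t : R => - (1 * t ^+ 2)) expR); last exact: continuous_expR.
  apply: cvgN; apply: cvgM; [exact: cvg_cst|exact: exprn_continuous].
apply: (has_integral_primitive (F := fun t : R => - (t * expR (- (1 * t ^+ 2)))) h4).
- move=> x x0; apply: cvgM; last exact: c2.
  apply: cvgB; last exact: cvg_cst.
  apply: cvgM; [exact: cvg_cst|exact: exprn_continuous].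
- move=> x x0; apply: is_derive_eq; rewrite /GRing.scale/=; ring.
- have : - (t * expR (- (1 * t ^+ 2))) @[t --> 0^'+] --> - ((0 : R) * expR (- (1 * 0 ^+ 2))).
    apply: cvg_at_right_filter; apply: cvgN; apply: cvgM; [exact: cvg_id|exact: c2].
  by rewrite mul0r oppr0.
- have -> : 0 = - 0 :> R by rewrite oppr0.
  apply: cvgN.
  apply: (squeeze_cvgr _ (cvg_cst 0) (@cvg_powR_expRy R 1 1 ler01 ltr01)).
  near=> x; have x1 : 1 <= x by near: x; exact: nbhs_pinfty_ge.
  have x0 : 0 <= x by exact: le_trans x1.
  rewrite mulr_ge0 ?expR_ge0//= powRr1// ler_wpM2l// ler_expR !mul1r lerN2 expr2.
  by rewrite ler_peMr.
Unshelve. all: by end_near. Qed.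

(** Legendre's duplication formula at [m + 2], cleared of denominators. *)
Lemma Gamma_half_fact (m : nat) :
  Gamma (m%:R + 5 / 2) * m`!%:R * 4 ^+ m * 8 * m.+1%:R = Num.sqrt pi * (m.*2.+3)`!%:R :> R.
Proof.
elim: m => [|m ih].
  rewrite add0r (_ : 5 / 2 = 3 / 2 + 1 :> R); last by lra.
  rewrite GammaS ?Gamma32; last by lra.
  rewrite (_ : (0.*2.+3)`! = 6)// (_ : 0`! = 1)// expr0.
  by move: (Num.sqrt pi) => u; field.
rewrite doubleS (factS m.*2.+4) (factS m.*2.+3) 2!natrM mulrCA mulrA.
have -> : m.+1%:R + 5 / 2 = m%:R + 5 / 2 + 1 :> R by rewrite -natr1; ring.
rewrite GammaS; last first.
  have := ler0n R m; move: (m%:R : R) => u; lra.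
rewrite factS natrM.
have e1 : m.*2.+4.+1%:R = 2 * (m%:R + 5 / 2) :> R.
  rewrite (_ : m.*2.+4.+1 = (m.*2 + 5)%N); last by rewrite !addnS addn0.
  by rewrite natrD -mul2n natrM; field.
have e2 : m.*2.+4%:R = 2 * m.+2%:R :> R.
  by rewrite -natrM mul2n !doubleS.
transitivity (Gamma (m%:R + 5 / 2) * m`!%:R * 4 ^+ m * 8 * m.+1%:R
     * (m.*2.+4.+1%:R * m.*2.+4%:R) : R).
  rewrite e1 e2 exprS.
  by move: (Gamma _) => a; field.
rewrite ih.
by move: (Num.sqrt pi) (m.*2.+3`!%:R : R) (m.*2.+4.+1%:R : R) (m.*2.+4%:R : R) => a b c d; ring.
Qed.

(** The linear terms cancel, so the right side has one term less. The other coefficients come from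
    [1 / (2m+2)! - 1 / (2m+3)! = (2m+2) / (2m+3)!]. *)
Lemma sin_cos_series (x : R) (n : nat) :
  series (sin_coeff' x) n.+1 - x * series (cos_coeff' x) n.+1 =
  \sum_(0 <= m < n) ((-1) ^+ m * x ^+ m.*2.+3 * (2 * m.+1%:R) / (m.*2.+3)`!%:R).
Proof.
elim: n => [|n ih].
  rewrite /series/= !big_nat1 big_geq// /sin_coeff' /cos_coeff'/=.
  by rewrite !expr0z expr0 expr1 !divr1 !mul1r mulr1 subrr.
rewrite [in RHS]big_nat_recr//= -ih.
have sS (u : nat -> R) k : series u k.+1 = series u k + u k.
  by rewrite /series/= big_nat_recr.
rewrite (sS _ n.+1) (sS (cos_coeff' x) n.+1).
rewrite /sin_coeff' /cos_coeff' -!exprnP !doubleS (factS n.*2.+2) natrM.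
have f0 : n.*2.+2`!%:R != 0 :> R by rewrite pnatr_eq0 -lt0n fact_gt0.
have e : 2 * n.+1%:R = n.*2.+3%:R - 1 :> R.
  by rewrite -natrM mul2n doubleS -[n.*2.+3%:R]natr1 addrK.
have g0 : n.*2.+3%:R != 0 :> R by rewrite pnatr_eq0.
rewrite e [(-1) ^+ n.+1]exprS [x ^+ n.*2.+3]exprS.
move: f0 g0 (series _ _) (series _ _); move: ((-1) ^+ n) (x ^+ n.*2.+2) (n.*2.+2`!%:R : R) (n.*2.+3%:R : R).
by move=> a b c d c0 d0 u v; field; rewrite c0 d0.
Qed.

(** The factor [x ^ (3/2)] makes all exponents integers. The partial sums of both sides then agree
    term by term, by the duplication formula. *)
Lemma BesselJ32 (x : R) : 0 < x ->
  x `^ (1 + 1 / 2) * BesselJ (1 + 1 / 2) x = Num.sqrt (2 / pi) * (sin x - x * cos x).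
Proof.
move=> x0; have nu0 : 0 <= 1 + 1 / 2 :> R by lra.
have x20 : 0 < x / 2 by rewrite divr_gt0.
rewrite BesselJE//.
have c1 : x `^ (1 + 1 / 2) * ((x / 2) `^ (1 + 1 / 2) * pseries (bessel_coef (1 + 1 / 2)) ((x / 2) ^+ 2) n) @[n --> \oo]
   --> x `^ (1 + 1 / 2) * ((x / 2) `^ (1 + 1 / 2) * bessel_pseries (1 + 1 / 2) ((x / 2) ^+ 2)).
  by apply: cvgMr; apply: cvgMr; exact: is_cvg_bessel_pseries.
have c2 : Num.sqrt (2 / pi) * (series (sin_coeff' x) n.+1 - x * series (cos_coeff' x) n.+1) @[n --> \oo]
    --> Num.sqrt (2 / pi) * (sin x - x * cos x).
  apply: cvgMr; apply: cvgB.
    by rewrite (cvg_shiftS (series (sin_coeff' x))); exact: cvg_sin_coeff'.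
  apply: cvgMr; rewrite (cvg_shiftS (series (cos_coeff' x))); exact: cvg_cos_coeff'.
suff E n : x `^ (1 + 1 / 2) * ((x / 2) `^ (1 + 1 / 2) * pseries (bessel_coef (1 + 1 / 2)) ((x / 2) ^+ 2) n)
   = Num.sqrt (2 / pi) * (series (sin_coeff' x) n.+1 - x * series (cos_coeff' x) n.+1).
  by move: c1; rewrite (funext E) => c1; exact: (cvg_unique _ c1 c2).
rewrite sin_cos_series /pseries /series/= !mulr_sumr; apply: eq_bigr => m _.
have s2 : 0 < Num.sqrt 2 :> R by rewrite sqrtr_gt0.
have s22 : Num.sqrt 2 * Num.sqrt 2 = 2 :> R by rewrite -expr2 sqr_sqrtr.
have sp : 0 < Num.sqrt pi :> R by rewrite sqrtr_gt0 pi_gt0.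
rewrite mulrA -powRM ?ltW// (_ : 1 + 1 / 2 = 3%:R * 2^-1 :> R); last by field.
have -> : x * (x / 2) = x ^+ 2 / 2 by field.
rewrite powRrM powR_mulrn ?divr_ge0 ?sqr_ge0//.
rewrite powR12_sqrt ?exprn_ge0 ?divr_ge0 ?sqr_ge0//.
have -> : Num.sqrt ((x ^+ 2 / 2) ^+ 3) = x ^+ 3 / (2 * Num.sqrt 2).
  have -> : (x ^+ 2 / 2) ^+ 3 = (x ^+ 3 / (2 * Num.sqrt 2)) ^+ 2.
    by rewrite !expr_div_n !exprMn sqr_sqrtr//; field.
  by rewrite sqrtr_sqr ger0_norm// divr_ge0 ?exprn_ge0 ?mulr_ge0 ?ltW.
rewrite sqrtrM// sqrtrV ?pi_ge0//.
rewrite /bessel_coef (_ : m%:R + 3 * 2^-1 + 1 = m%:R + 5 / 2); last by field.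
have H := Gamma_half_fact m.
have G0 : Gamma (m%:R + 5 / 2) != 0 :> R.
  by rewrite gt_eqF// Gamma_gt0//; have := ler0n R m; move: (m%:R : R) => u; lra.
have f0 : m`!%:R != 0 :> R by rewrite pnatr_eq0 -lt0n fact_gt0.
have g0 : m.*2.+3`!%:R != 0 :> R by rewrite pnatr_eq0 -lt0n fact_gt0.
have h0 : 4 ^+ m != 0 :> R by rewrite expf_neq0// pnatr_eq0.
have m0 : m.+1%:R != 0 :> R by rewrite pnatr_eq0.
have -> : m.*2.+3`!%:R = Gamma (m%:R + 5 / 2) * m`!%:R * 4 ^+ m * 8 * m.+1%:R / Num.sqrt pi :> R.
  by rewrite H mulrC mulKf// gt_eqF.
have -> : ((x / 2) ^+ 2) ^+ m = x ^+ m.*2 / 4 ^+ m.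
  by rewrite -exprM expr_div_n mul2n -[2 ^+ m.*2]/((2 : R) ^+ m.*2) -[in 2 ^+ _]mul2n (exprM 2) -natrX.
have -> : x ^+ m.*2.+3 = x ^+ 3 * x ^+ m.*2 by rewrite -exprD addnC addn3.
have s2n : Num.sqrt 2 != 0 :> R by rewrite gt_eqF.
have spn : Num.sqrt pi != 0 :> R by rewrite gt_eqF.
have -> : Num.sqrt 2 / Num.sqrt pi = 2 / (Num.sqrt 2 * Num.sqrt pi) :> R.
  by rewrite -[X in X / (_ * _)]s22; field; rewrite s2n spn.
move: (Gamma _) G0 (m`!%:R : R) f0 (4 ^+ m : R) h0 (m.+1%:R : R) m0 (Num.sqrt 2) s2n (Num.sqrt pi) spn ((-1) ^+ m) (x ^+ 3) (x ^+ m.*2).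
move=> {H s2 s22 sp} a a0 b b0 c c0 d d0 e e0 f ff0 g k l.
by field; rewrite ?a0 ?b0 ?c0 ?d0 ?e0 ?ff0.
Qed.

End Bessel_three_halves.

(** * Laplace transforms of Bessel functions *)

Section Laplace_Bessel.
Context {R : realType}.
Notation mu := (@lebesgue_measure R).
Notation D0 := (`]0, +oo[%classic : set R).
Implicit Types (nu c p r t s : R).

(** The Gamma factors of coefficient and moment cancel. The free [d] stands for the sign [(-1) ^ m]
    in the series itself and for [1] in its majorant. *)
Lemma gauss_Hankel_value nu c p (m : nat) (d : R) : 0 <= nu -> 0 < c -> 0 < p ->
  (c / 2) `^ nu * (d / (m`!%:R * Gamma (m%:R + nu + 1)) * ((c / 2) ^+ 2) ^+ m) *
    (Gamma (m%:R + nu + 1) / (2 * p `^ (m%:R + nu + 1))) =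
  (c / 2) `^ nu / (2 * p `^ (nu + 1)) * (d * ((c ^+ 2 / (4 * p)) ^+ m / m`!%:R)).
Proof.
move=> nu0 c0 p0.
have G0 : Gamma (m%:R + nu + 1) != 0.
  by rewrite gt_eqF// Gamma_gt0// lerDr addr_ge0.
have f0 : m`!%:R != 0 :> R by rewrite pnatr_eq0 -lt0n fact_gt0.
have -> : m%:R + nu + 1 = m%:R + (nu + 1) by rewrite addrA.
rewrite addrA in G0 *; rewrite -[X in p `^ X]addrA.
rewrite (@powRD _ p m%:R) ?(gt_eqF p0) ?implybT// powR_mulrn ?(ltW p0)//.
have -> : (c ^+ 2 / (4 * p)) ^+ m = ((c / 2) ^+ 2) ^+ m / p ^+ m.
  by rewrite -expr_div_n; congr (_ ^+ _); field; rewrite gt_eqF.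
have q0 : p ^+ m != 0 by rewrite expf_neq0// gt_eqF.
have q1 : p `^ (nu + 1) != 0 by rewrite gt_eqF// powR_gt0.
move: (Gamma _) G0 (m`!%:R : R) f0 (p ^+ m) q0 (p `^ _) q1 ((c / 2) `^ nu) (((c / 2) ^+ 2) ^+ m).
by move=> a a0 b b0 e e0 f ff0 g h; field; rewrite ?a0 ?b0 ?e0 ?ff0.
Qed.

Lemma has_integral_gauss_Hankel nu c p : 0 <= nu -> 0 < c -> 0 < p ->
  has_integral (fun t => t `^ (nu + 1) * BesselJ nu (c * t) * expR (- (p * t ^+ 2)))
    ((c / 2) `^ nu / (2 * p `^ (nu + 1)) * expR (- (c ^+ 2 / (4 * p)))).
Proof.
move=> nu0 c0 p0.
pose A := (c / 2) `^ nu / (2 * p `^ (nu + 1)); pose X := c ^+ 2 / (4 * p).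
pose a (m : nat) := m%:R + nu + 1.
have a1 m : 1 <= a m by rewrite lerDr addr_ge0.
pose e m t := t `^ (2 * a m - 1) * expR (- (p * t ^+ 2)).
have eI m : has_integral (e m) (Gamma (a m) / (2 * p `^ (a m))).
  exact: has_integral_gauss_moment.
pose k (d : nat -> R) m := (c / 2) `^ nu * (d m / (m`!%:R * Gamma (a m)) * ((c / 2) ^+ 2) ^+ m).
have kI d m : has_integral (fun t => k d m * e m t) (A * (d m * (X ^+ m / m`!%:R))).
  by rewrite -gauss_Hankel_value//; exact: has_integralZ.
pose sg (m : nat) : R := (-1) ^+ m.
pose F t := t `^ (nu + 1) * BesselJ nu (c * t) * expR (- (p * t ^+ 2)).
have mF : measurable_fun D0 F.
  apply: continuous_measurable_D0 => t t0; apply: cvgM; last first.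
    apply: (@continuous_comp _ _ _ (fun t : R => - (p * t ^+ 2)) expR); last exact: continuous_expR.
    apply: cvgN; apply: cvgM; [exact: cvg_cst|exact: exprn_continuous].
  apply: cvgM; first exact: continuous_powR.
  apply: (@continuous_comp _ _ _ (fun t => c * t) (BesselJ nu)).
    apply: cvgM; [exact: cvg_cst|exact: cvg_id].
  have [dJ _] := is_derive_BesselJ nu0 (mulr_gt0 c0 t0).
  by apply: differentiable_continuous; exact/derivable1_diffP.
have X0 : 0 <= X by rewrite divr_ge0 ?exprn_ge0 ?mulr_ge0// ltW.
have kge0 m t : 0 <= k (fun=> 1) m * e m t.
  rewrite mulr_ge0//; last by rewrite mulr_ge0 ?powR_ge0 ?expR_ge0.
  rewrite mulr_ge0 ?powR_ge0//; apply: mulr_ge0; last by rewrite exprn_ge0 ?sqr_ge0.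
  by rewrite divr_ge0//; apply: mulr_ge0; [exact: ler0n|exact/ltW/Gamma_gt0].
have [] := @has_integral_series R (fun m t => k sg m * e m t)
   (fun m t => k (fun=> 1) m * e m t) (fun m => A * (sg m * (X ^+ m / m`!%:R)))
   (fun m => A * (1 * (X ^+ m / m`!%:R))) F set0.
- exact: countable0.
- exact: mF.
- by move=> m; exact: kI.
- by move=> m; exact: (kI (fun=> 1)).
- move=> m t t0; rewrite -[leRHS]ger0_norm//.
  rewrite !normrM /sg normrX normrN1 expr1n normr1.
  exact: lexx.
- rewrite (_ : (fun m => _) = (fun m => A * exp_coeff X m)).
    by apply: is_cvg_seriesZ; exact: is_cvg_series_exp_coeff.
  by apply/funext => m; rewrite mul1r.
- move=> t t0 _; have ct0 : 0 < c * t by rewrite mulr_gt0.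
  have h := @cvg_BesselJ _ _ _ nu0 ct0.
  rewrite /F BesselJE//.
  have -> : series (fun m => k sg m * e m t) = (fun n => t `^ (nu + 1) *
      (\sum_(0 <= m < n) ((-1) ^+ m / (m`!%:R * Gamma (m%:R + nu + 1))
      * (c * t / 2) `^ (2 * m%:R + nu))) * expR (- (p * t ^+ 2))).
    apply/funext => n; rewrite /series/= mulr_sumr mulr_suml; apply: eq_bigr => m _.
    rewrite /k /e /sg /a -/(bessel_coef nu m) bessel_term//.
    have -> : c * t / 2 = c / 2 * t by field.
    rewrite (@powRM _ (c / 2) t) ?(ltW t0) ?divr_ge0 ?(ltW c0)//.
    have -> : ((c / 2 * t) ^+ 2) ^+ m = ((c / 2) ^+ 2) ^+ m * (t ^+ 2) ^+ m.
      by rewrite -[RHS]exprMn -[in RHS]exprMn.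
    have -> : 2 * (m%:R + nu + 1) - 1 = nu + ((nu + 1) + (2 * m)%:R) by rewrite natrM; ring.
    rewrite (@powRD _ t nu) ?(gt_eqF t0) ?implybT//.
    rewrite (@powRD _ t (nu + 1)) ?(gt_eqF t0) ?implybT//.
    rewrite powR_mulrn ?(ltW t0)// exprM.
    move: (bessel_coef nu m) (expR _) (t `^ nu) (t `^ (nu + 1)) ((t ^+ 2) ^+ m) (((c / 2) ^+ 2) ^+ m) ((c / 2) `^ nu).
    by move=> *; ring.
  by apply: cvgMl; apply: cvgMr.
move=> hF hc.
have hc' : series (fun m => A * (sg m * (X ^+ m / m`!%:R))) @ \oo --> A * expR (- X).
  rewrite (_ : (fun m => _) = (fun m => A * exp_coeff (- X) m)).
    rewrite (_ : series _ = (fun n => A * series (exp_coeff (- X)) n)).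
      by apply: cvgMr; exact: is_cvg_series_exp_coeff.
    by apply/funext => n; rewrite /series/= mulr_sumr.
  by apply/funext => m; congr (A * _); rewrite /exp_coeff/= exprNn -mulrA.
by rewrite -(cvg_unique _ hc hc').
Qed.

(** The hypotheses on [A'] are Tonelli's criterion. [Phi] is extended by zero from the open quadrant
    to the plane, where the product measure lives. *)
Lemma has_integral_Fubini (Phi : R -> R -> R) (A A' B : R -> R) (a a' b : R) :
  measurable_fun [set: R * R] (fun z => Phi z.1 z.2) ->
  (forall t, 0 < t -> has_integral (Phi t) (A t)) ->
  (forall t, 0 < t -> has_integral (fun s => `|Phi t s|) (A' t)) ->
  (forall s, 0 < s -> has_integral (Phi ^~ s) (B s)) ->
  has_integral A a -> has_integral A' a' -> has_integral B b -> a = b.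
Proof.
move=> mP hA hA' hB [_ ha] [_ ha'] [_ hb].
pose f := (EFin \o (fun z : R * R => Phi z.1 z.2)) \_ (D0 `*` D0).
have mD : measurable (D0 `*` D0 : set (measurableTypeR R * measurableTypeR R)) by exact: measurableX.
have mf : measurable_fun setT f.
  rewrite /f; apply/(measurable_restrictT _ mD); apply: measurable_funTS.
  by apply: measurableT_comp; [exact: EFin_measurable|exact: mP].
have fE t s : f (t, s) = (if (0 < t) && (0 < s) then (Phi t s)%:E else 0%E).
  rewrite /f patchE; congr (if _ then _ else _).
  by apply/idP/idP; rewrite inE/= !in_itv/= !andbT => /andP.
have inD t : (t \in D0) = (0 < t) by apply/idP/idP; rewrite inE/= in_itv/= andbT.
have int1 (h : \bar R -> \bar R) t : h 0%E = 0%E ->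
    (\int[mu]_s h (f (t, s)) = if (0 < t)%R then \int[mu]_(s in D0) h (Phi t s)%:E else 0)%E.
  move=> h0; case: ifPn => t0.
    rewrite [RHS]integral_mkcond; apply: eq_integral => s _.
    by rewrite patchE fE t0/= inD; case: ifPn.
  by apply: integral0_eq => s _; rewrite fE (negbTE t0).
have int2 s : (\int[mu]_t f (t, s) = if (0 < s)%R then \int[mu]_(t in D0) (Phi t s)%:E else 0)%E.
  case: ifPn => s0.
    rewrite [RHS]integral_mkcond; apply: eq_integral => t _.
    by rewrite patchE fE s0/= andbT inD; case: ifPn.
  by apply: integral0_eq => t _; rewrite fE (negbTE s0) andbF.
have fi : (mu \x mu)%E.-integrable setT f.
  apply/integrable12ltyP => //.
  rewrite [X in (X < _)%E](_ : _ = a'%:E) ?ltry//.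
  rewrite -ha' [RHS]integral_mkcond; apply: eq_integral => t _.
  rewrite (int1 abse) ?abse0// patchE inD; case: ifPn => // t0.
  by have [_ <-] := hA' _ t0.
have := Fubini fi.
rewrite [X in X = _ -> _](_ : _ = a%:E); last first.
  rewrite -ha [RHS]integral_mkcond; apply: eq_integral => t _.
  rewrite (int1 id)// patchE inD; case: ifPn => // t0.
  by have [_ <-] := hA _ t0.
rewrite [X in _ = X -> _](_ : _ = b%:E); last first.
  rewrite -hb [RHS]integral_mkcond; apply: eq_integral => s _.
  rewrite int2 patchE inD; case: ifPn => // s0.
  by have [_ <-] := hB _ s0.
by case.
Qed.

End Laplace_Bessel.

(** * Gaussian subordination of the exponential *)

Section subordination.
Context {R : realType}.
Notation mu := (@lebesgue_measure R).
Notation D0 := (`]0, +oo[%classic : set R).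
Implicit Types (nu c p r t s : R).

(** The error function up to affine normalisation: it runs from 0 to [sqrt pi]. *)
Definition gauss_prim (z : R) : R := \int[mu]_(s in `]-oo, z]) gauss_fun s.

Lemma is_derive_gauss_prim (z : R) : is_derive z 1 gauss_prim (expR (- z ^+ 2)).
Proof.
have z1 : z < z + 1 by rewrite ltrDl.
have iz : mu.-integrable [set` Interval -oo%O (BRight (z + 1))] (EFin \o @gauss_fun R).
  by apply: integrableS (@integrableT_gauss R).
have [||dE E'] := @continuous_FTC1 R gauss_fun -oo%O z (z + 1) z1 iz.
- by rewrite ltNyr.
- exact: continuous_gauss_fun.
- split; first exact: dE.
  rewrite -derive1E; exact: E'.
Qed.

(** At each point the indicator of the half-line below [u n] is eventually the constant [b]. One
    dominated convergence thus serves both ends, [b] being true for [+oo] and false for [-oo]. *)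
Lemma cvg_gauss_prim_seq (u : nat -> R) (b : bool) :
  (forall x, \forall n \near \oo, (x <= u n) = b) ->
  gauss_prim (u n) @[n --> \oo] --> (if b then Num.sqrt pi else 0 : R).
Proof.
move=> ub.
have mg : measurable_fun setT (EFin \o @gauss_fun R).
  by apply/measurable_EFinP; exact: measurable_gauss_fun.
have [] := @dominated_convergence _ _ R mu setT _
  (fun n => (EFin \o @gauss_fun R) \_ (`]-oo, u n]%classic))
  (fun x => if b then (gauss_fun x)%:E else 0%E) (EFin \o @gauss_fun R).
- by [].
- move=> n; apply/measurable_restrict => //; exact: measurable_funS mg.
- by case: b {ub}.
- apply: aeW => x _; apply: cvg_near_cst; have := ub x; apply: filterS => n un.
  rewrite patchE -un; congr (if _ then _ else _).
  by apply/idP/idP; rewrite inE/= in_itv.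
- exact: integrableT_gauss.
- apply: aeW => x n _; rewrite patchE; case: ifPn => _ /=; rewrite ?lee_fin.
    by rewrite ger0_norm ?gauss_fun_ge0.
  by rewrite normr0 gauss_fun_ge0.
move=> _ _.
have -> : (\int[mu]_(x in setT) (if b then (gauss_fun x)%:E else 0) = (if b then Num.sqrt pi else 0)%:E)%E.
  by case: b {ub}; [exact: integralT_gauss|exact: integral0].
under [X in X @ _ --> _]eq_fun do rewrite -integral_mkcondr setTI.
by move/fine_cvg.
Qed.

Lemma cvgy_gauss_prim : gauss_prim z @[z --> +oo] --> (Num.sqrt pi : R).
Proof.
apply/cvg_pinftyP => u uy; apply: (@cvg_gauss_prim_seq u true) => x.
near=> n; apply/idP; near: n; move/cvgryPge : uy; apply.
Unshelve. all: by end_near. Qed.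

Lemma cvgNy_gauss_prim : gauss_prim z @[z --> -oo] --> (0 : R).
Proof.
apply/cvgNy_compNP; apply/cvg_pinftyP => u uy.
apply: (@cvg_gauss_prim_seq (fun n => - u n) false) => x.
near=> n; apply/negbTE; rewrite -ltNge ltrNl; near: n; move/cvgryPgt : uy; apply.
Unshelve. all: by end_near. Qed.

(** The case [r = 0] is included because it bounds the argument with a plus sign from below. *)
Lemma cvg_subordination0 (t r : R) : 0 < t -> 0 <= r ->
  t / 2 / s - r * s @[s --> 0^'+] --> +oo.
Proof.
move=> t0 r0; apply/cvgryPge => M.
have N0 : 0 < `|M| + r + 1 by rewrite ltr_wpDl ?addr_ge0.
near=> s.
have s0 : 0 < s by near: s; exact: nbhs_right_gt.
have s1 : s <= 1 by near: s; apply: nbhs_right_le.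
have sM : s <= t / 2 / (`|M| + r + 1).
  by near: s; apply: nbhs_right_le; exact: divr_gt0 (divr_gt0 t0 (ltr0Sn _ 1)) N0.
have h : `|M| + r + 1 <= t / 2 / s by rewrite ler_pdivlMr// mulrC -ler_pdivlMr.
have rs : r * s <= r by rewrite ler_piMr.
have := ler_norm M; move: (t / 2 / s) (r * s) (`|M|) h rs => a b d; lra.
Unshelve. all: by end_near. Qed.

(* The explicit primitive combines the shifts [t / (2 s) + r s] and [t / (2 s) - r s]
   of a primitive of [exp (- z ^ 2)]. *)
Lemma has_integral_subordination (t r : R) : 0 < t -> 0 < r ->
  has_integral (fun s => s ^- 2 * expR (- (t ^+ 2 / 4 * s ^- 2 + r ^+ 2 * s ^+ 2)))
    (Num.sqrt pi / t * expR (- (r * t))).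
Proof.
move=> t0 r0.
(* The squares of [t / (2 s) + r s] and [t / (2 s) - r s] differ from
   [t ^ 2 / (4 s ^ 2) + r ^ 2 s ^ 2] by [r t] and [- r t]. The two weights therefore make both
   exponentials equal to the one in the integrand, and the terms [r] and [- r] of the inner
   derivatives cancel. *)
pose F s := - t^-1 * (expR (r * t) * gauss_prim (t / 2 / s + r * s)
   + expR (- (r * t)) * gauss_prim (t / 2 / s - r * s)).
have -> : Num.sqrt pi / t * expR (- (r * t)) =
   - t^-1 * (expR (r * t) * Num.sqrt pi + expR (- (r * t)) * 0) -
   - t^-1 * (expR (r * t) * Num.sqrt pi + expR (- (r * t)) * Num.sqrt pi).
  by move: (expR _) (expR _) (Num.sqrt _) => a b d; field; rewrite gt_eqF.
have dV s : 0 < s -> is_derive s 1 (fun s : R => s^-1) (- s ^- 2).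
  move=> s0; apply: is_derive_eq; first by apply: is_deriveV; rewrite gt_eqF.
  by rewrite /GRing.scale/= mulr1.
have dP (e : R) s : 0 < s -> is_derive s 1 (fun s => gauss_prim (t / 2 / s + e * s))
   ((- (t / 2) * s ^- 2 + e) * expR (- (t / 2 / s + e * s) ^+ 2)).
  move=> s0; have ? := dV _ s0.
  have d1 : is_derive s 1 (fun s => t / 2 / s + e * s) (- (t / 2) * s ^- 2 + e).
    by apply: is_derive_eq; rewrite /GRing.scale/=; ring.
  have := @is_derive1_comp R gauss_prim (fun s => t / 2 / s + e * s) s _ _
    (is_derive_gauss_prim _) d1.
  by rewrite [X in is_derive _ _ _ X -> _]mulrC.
have dF s : 0 < s -> is_derive s 1 F (s ^- 2 * expR (- (t ^+ 2 / 4 * s ^- 2 + r ^+ 2 * s ^+ 2))).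
  move=> s0; have d1 := dP r s s0; have := dP (- r) s s0.
  under eq_fun do rewrite (mulNr r); rewrite (mulNr r) => d2.
  rewrite /F; apply: is_derive_eq; rewrite /GRing.scale/=.
  have sn : s != 0 by rewrite gt_eqF.
  have -> : expR (- (t ^+ 2 / 4 * s ^- 2 + r ^+ 2 * s ^+ 2)) =
      expR (r * t) * expR (- (t / 2 / s + r * s) ^+ 2).
    by rewrite -expRD; congr expR; field.
  have e2 : expR (- (r * t)) * expR (- (t / 2 / s - r * s) ^+ 2) =
      expR (r * t) * expR (- (t / 2 / s + r * s) ^+ 2).
    by rewrite -!expRD; congr expR; field.
  transitivity (- t^-1 * ((- (t / 2) * s ^- 2 + r) * (expR (r * t) * expR (- (t / 2 / s + r * s) ^+ 2))
     + (- (t / 2) * s ^- 2 - r) * (expR (- (r * t)) * expR (- (t / 2 / s - r * s) ^+ 2)))).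
    by move: (expR _) (expR _) (expR _) (expR _) => a b d e; ring.
  rewrite e2; move: (expR _ * expR _) => a.
  by field; rewrite sn gt_eqF.
have cV s : 0 < s -> {for s, continuous (fun s : R => s ^- 2)}.
  by move=> s0; apply: cvgV; [rewrite expf_neq0// gt_eqF|exact: exprn_continuous].
apply: (has_integral_FTC (F := F)).
- by move=> s s0; rewrite mulr_ge0 ?expR_ge0// invr_ge0 sqr_ge0.
- move=> s s0; apply: cvgM; first exact: cV.
  apply: (@continuous_comp _ _ _ (fun s : R => - (t ^+ 2 / 4 * s ^- 2 + r ^+ 2 * s ^+ 2)) expR);
    last exact: continuous_expR.
  apply: cvgN; apply: cvgD; apply: cvgM; try exact: cvg_cst; first exact: cV.
  exact: exprn_continuous.
- rewrite /F; apply: cvgMr; apply: cvgD; apply: cvgMr.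
    apply: (cvg_comp _ gauss_prim _ cvgy_gauss_prim).
    apply: (@ger_cvgy _ _ _ _ (fun s => t / 2 / s - 0 * s)); last exact: cvg_subordination0.
    near=> s; rewrite mul0r subr0 lerDl mulr_ge0// ltW//.
  apply: (cvg_comp _ gauss_prim _ cvgy_gauss_prim).
  by apply: cvg_subordination0 => //; exact: ltW.
- rewrite /F; apply: cvgMr; apply: cvgD; apply: cvgMr.
    apply: (cvg_comp _ gauss_prim _ cvgy_gauss_prim).
    apply: (@ger_cvgy _ _ _ _ (fun s => r * s)); last exact: gt0_cvgMry.
    near=> s; rewrite lerDr !divr_ge0// ltW//.
  apply: (cvg_comp _ gauss_prim _ cvgNy_gauss_prim).
  apply/cvgrNyPle => M; near=> s.
  have s1 : 1 <= s by near: s; exact: nbhs_pinfty_ge.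
  have s0 : 0 < s by exact: lt_le_trans s1.
  have ts : t / 2 / s <= t / 2 by rewrite ler_pdivrMr// ler_peMr// divr_ge0// ltW.
  have rs : (t / 2 - M) <= r * s.
    by rewrite -ler_pdivrMl//; near: s; exact: nbhs_pinfty_ge.
  move: (t / 2 / s) (r * s) ts rs => a b; lra.
Unshelve. all: by end_near. Qed.

End subordination.

(** * Laplace transforms by subordination *)

Section Laplace_of_Bessel.
Context {R : realType}.
Notation mu := (@lebesgue_measure R).
Notation D0 := (`]0, +oo[%classic : set R).
Implicit Types (nu c p r t s : R).

Lemma measurable_powR_BesselJ nu c (a : R) : 0 <= nu -> 0 < c ->
  measurable_fun D0 (fun t => t `^ a * BesselJ nu (c * t)).
Proof.
move=> nu0 c0; apply: continuous_measurable_D0 => t t0.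
apply: cvgM; first exact: continuous_powR.
apply: (@continuous_comp _ _ _ (fun t => c * t) (BesselJ nu)).
  apply: cvgM; [exact: cvg_cst|exact: cvg_id].
have [dJ _] := is_derive_BesselJ nu0 (mulr_gt0 c0 t0).
by apply: differentiable_continuous; exact/derivable1_diffP.
Qed.

Lemma norm_powR_BesselJ nu (C t c : R) : 0 < t -> 0 < c ->
  (forall x, 0 < x -> `|BesselJ nu x| <= C * x `^ (- 2^-1)) ->
  `|t `^ nu * BesselJ nu (c * t)| <= C * c `^ (- 2^-1) * t `^ (nu - 2^-1).
Proof.
move=> t0 c0 HC; rewrite normrM ger0_norm ?powR_ge0//.
apply: (le_trans (ler_wpM2l (powR_ge0 _ _) (HC _ (mulr_gt0 c0 t0)))).
rewrite powRM ?(ltW c0) ?(ltW t0)// (@powRD _ t nu) ?(gt_eqF t0) ?implybT//.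
move: (t `^ nu) (t `^ (- 2^-1)) (c `^ _) => a b d.
by have -> : a * (C * (d * b)) = C * d * (a * b) by ring.
Qed.

(** For [2^-1 <= nu] the exponent [nu - 1/2] left by the decay of the Bessel function is
    nonnegative, so the majorant is a power with exponential damping that is bounded near 0. *)
Lemma integrable_laplace_BesselJ nu c r : 2^-1 <= nu -> 0 < c -> 0 < r ->
  has_integral (fun t => t `^ nu * BesselJ nu (c * t) * expR (- (r * t)))
    (\int[mu]_(t in D0) (t `^ nu * BesselJ nu (c * t) * expR (- (r * t)))).
Proof.
move=> nu2 c0 r0; have nu0 : 0 <= nu by rewrite (le_trans _ nu2).
have [C HC] := BesselJ_decay nu0.
have nu20 : 0 <= nu - 2^-1 by rewrite subr_ge0.
apply: (has_integral_le_norm _ _ (has_integralZ (C * c `^ (- 2^-1)) (has_integral_powR_expR nu20 r0))).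
  apply: measurable_funM; first exact: measurable_powR_BesselJ.
  apply: measurableT_comp => //; apply: measurable_funN.
  exact: mulrl_measurable.
move=> t t0; rewrite normrM (ger0_norm (expR_ge0 _)) mulrA ler_wpM2r ?expR_ge0//.
exact: norm_powR_BesselJ.
Qed.

(* Gaussian subordination: write [exp (- r t)] as a mixture of the Gaussians
   [exp (- t ^ 2 / (4 s ^ 2))], whose Hankel transform is again Gaussian. *)
Lemma has_integral_laplace_BesselJ nu c r : 2^-1 <= nu -> 0 < c -> 0 < r ->
  has_integral (fun t => t `^ nu * BesselJ nu (c * t) * expR (- (r * t)))
    ((2 * c) `^ nu * Gamma (nu + 2^-1) /
     (Num.sqrt pi * (c ^+ 2 + r ^+ 2) `^ (nu + 2^-1))).
Proof.
move=> nu2 c0 r0; have nu0 : 0 <= nu by rewrite (le_trans _ nu2).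
have hA := integrable_laplace_BesselJ nu2 c0 r0.
set L := (\int[mu]_(t in D0) _) in hA.
suff -> : (2 * c) `^ nu * Gamma (nu + 2^-1) / (Num.sqrt pi * (c ^+ 2 + r ^+ 2) `^ (nu + 2^-1)) = L by [].
have sp : 0 < Num.sqrt pi :> R by rewrite sqrtr_gt0 pi_gt0.
pose q := c ^+ 2 + r ^+ 2.
have q0 : 0 < q by rewrite addr_gt0 ?exprn_gt0.
have c20 : 0 <= c / 2 by rewrite divr_ge0// ltW.
pose J t := t `^ (nu + 1) * BesselJ nu (c * t).
(* Cut off to the positive half-line, so that the integrand of Fubini's theorem is measurable on the
   whole plane. For the same reason [Phi] uses [powR] with exponent -2 in place of [s ^- 2]. *)
pose phi := J \_ D0.
have phiE t : 0 < t -> phi t = J t.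
  by move=> t0; rewrite /phi patchE mem_set//= in_itv/= t0.
have mphi : measurable_fun setT phi.
  apply/(measurable_restrictT J) => //; exact: measurable_powR_BesselJ.
pose Phi t s := phi t * (s `^ (- 2%:R) * expR (- (t ^+ 2 / 4 * s `^ (- 2%:R) + r ^+ 2 * s ^+ 2))).
pose A t := Num.sqrt pi * (t `^ nu * BesselJ nu (c * t) * expR (- (r * t))).
pose K := (c / 2) `^ nu / 2 * 4 `^ (nu + 1).
(* The Hankel transform with [p = 1 / (4 s ^ 2)] yields [exp (- c ^ 2 s ^ 2)] and [s ^ (2 nu + 2)].
   What remains is a Gaussian in [s] with parameter [q = c ^ 2 + r ^ 2], whose moment produces the
   power of [c ^ 2 + r ^ 2]. *)
pose B s := K * (s `^ (2 * (nu + 2^-1) - 1) * expR (- (q * s ^+ 2))).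
have a1 : 1 <= nu + 2^-1 by move: nu2; lra.
have hPhi t : 0 < t -> has_integral (Phi t) (A t).
  move=> t0; have -> : A t = phi t * (Num.sqrt pi / t * expR (- (r * t))).
    rewrite phiE// /J /A powRD ?(gt_eqF t0) ?implybT// powRr1 ?(ltW t0)//.
    move: (BesselJ _ _) (expR _) (Num.sqrt _) (t `^ nu) => a b d e.
    by field; rewrite gt_eqF.
  apply: eq_has_integral (has_integralZ (phi t) (has_integral_subordination t0 r0)) => s s0.
  by rewrite /Phi powR_invn// ltW.
have hPhi' t : 0 < t -> has_integral (fun s => `|Phi t s|) `|A t|.
  move=> t0; have -> : `|A t| = `|phi t| * (Num.sqrt pi / t * expR (- (r * t))).
    rewrite phiE// /J /A powRD ?(gt_eqF t0) ?implybT// powRr1 ?(ltW t0)//.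
    rewrite !normrM (ger0_norm (ltW sp)) (ger0_norm (powR_ge0 _ _)) (ger0_norm (expR_ge0 _)) (ger0_norm (ltW t0)).
    move: (`|BesselJ _ _|) (expR _) (Num.sqrt _) (t `^ nu) => a b d e.
    by field; rewrite gt_eqF.
  apply: eq_has_integral (has_integralZ `|phi t| (has_integral_subordination t0 r0)) => s s0.
  rewrite /Phi powR_invn ?(ltW s0)// [RHS]normrM; congr (_ * _).
  by rewrite ger0_norm// mulr_ge0 ?expR_ge0// invr_ge0 sqr_ge0.
have hB s : 0 < s -> has_integral (Phi ^~ s) (B s).
  move=> s0; pose p := (4 * s ^+ 2)^-1.
  have p0 : 0 < p by rewrite invr_gt0 mulr_gt0// exprn_gt0.
  have h := has_integralZ (s ^- 2 * expR (- (r ^+ 2 * s ^+ 2))) (has_integral_gauss_Hankel nu0 c0 p0).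
  have -> : B s = s ^- 2 * expR (- (r ^+ 2 * s ^+ 2)) * ((c / 2) `^ nu / (2 * p `^ (nu + 1)) * expR (- (c ^+ 2 / (4 * p)))).
    have -> : p `^ (nu + 1) = (4 `^ (nu + 1) * s `^ (2%:R * nu + 2%:R))^-1.
      rewrite /p -(@powR_inv1 _ (4 * s ^+ 2)) ?(mulr_ge0 (ler0n _ 4) (sqr_ge0 s))//.
      rewrite -powRrM mulN1r powRN; congr (_^-1).
      rewrite powRM ?sqr_ge0//; congr (_ * _).
      rewrite -powR_mulrn ?(ltW s0)// -powRrM; congr (_ `^ _); ring.
    have e1 : expR (- (q * s ^+ 2)) = expR (- (r ^+ 2 * s ^+ 2)) * expR (- (c ^+ 2 / (4 * p))).
      rewrite -expRD /q /p; congr expR; field; by rewrite gt_eqF.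
    rewrite /B /K e1 (_ : 2 * (nu + 2^-1) - 1 = 2%:R * nu); last by field.
    rewrite (@powRD _ s) ?(gt_eqF s0) ?implybT// powR_mulrn ?(ltW s0)//.
    have n1 : 4 `^ (nu + 1) != 0 :> R by rewrite gt_eqF// powR_gt0.
    have n2 : s `^ (2%:R * nu) != 0 by rewrite gt_eqF// powR_gt0.
    have sn : s != 0 by rewrite gt_eqF.
    move: (4 `^ (nu + 1)) n1 (s `^ (2%:R * nu)) n2 (expR _) (expR _) ((c / 2) `^ nu) => a an b bn d e f.
    by field; rewrite sn an bn.
  apply: eq_has_integral h => t t0.
  rewrite /Phi phiE// powR_invn ?(ltW s0)//.
  have -> : expR (- (t ^+ 2 / 4 * s ^- 2 + r ^+ 2 * s ^+ 2)) = expR (- (r ^+ 2 * s ^+ 2)) * expR (- (p * t ^+ 2)).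
    by rewrite -expRD /p; congr expR; field; rewrite gt_eqF.
  rewrite /J; move: (expR _) (expR _) (BesselJ _ _) (t `^ _) (s ^- 2) => a b d e f; ring.
have hBI := has_integralZ K (has_integral_gauss_moment a1 q0).
have hAI := has_integralZ (Num.sqrt pi) hA.
have hA'I : has_integral (fun t => `|A t|) (\int[mu]_(t in D0) `|A t|).
  apply: integrable_has_integral; apply: integrable_norm.
  exact: hAI.1.
have mPhi : measurable_fun [set: R * R] (fun z => Phi z.1 z.2).
  have mf1 : measurable_fun [set: R * R] (fun z : R * R => z.1) by exact: measurable_fst.
  have mf2 : measurable_fun [set: R * R] (fun z : R * R => z.2) by exact: measurable_snd.
  have mV : measurable_fun [set: R * R] (fun z : R * R => z.2 `^ (- 2%:R)).
    exact: (measurableT_comp (measurable_powR (- 2%:R)) mf2).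
  apply: measurable_funM; first by apply: measurableT_comp mf1.
  apply: measurable_funM => //; apply: measurableT_comp => //.
  apply: measurable_funN; apply: measurable_funD; apply: measurable_funM => //.
    by apply: measurable_funM => //; exact: measurable_funX.
  exact: measurable_funX.
have := has_integral_Fubini mPhi hPhi hPhi' hB hAI hA'I hBI.
have -> : (2 * c) `^ nu = (c / 2) `^ nu * 4 `^ nu.
  by rewrite -powRM//; congr (_ `^ _); field.
have -> : K = (c / 2) `^ nu / 2 * (4 `^ nu * 4).
  by rewrite /K powRD ?pnatr_eq0 ?implybT// powRr1.
move: {hA hAI} L => L e.
have -> : L = (Num.sqrt pi)^-1 * (Num.sqrt pi * L) by rewrite mulKf// gt_eqF.
rewrite e -/q.
have qn : q `^ (nu + 2^-1) != 0 by rewrite gt_eqF// powR_gt0.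
have spn : Num.sqrt pi != 0 :> R by rewrite gt_eqF.
move: (Num.sqrt _) spn (q `^ _) qn (Gamma _) ((c / 2) `^ nu) (4 `^ nu) => {e} a an b bn d e f.
by field; rewrite an bn.
Qed.

End Laplace_of_Bessel.

(** * Summation over n *)

Section power_sums.
Context {R : realType}.
Implicit Types (x s : R).

(** A discrete integral test: each term after the first is at most [s^-1] times a difference of
    consecutive values of [x ^ (- s)], and these telescope. *)
Lemma series_natr_powR_le s (n : nat) : 0 < s ->
  series (fun k => k.+1%:R `^ (- (1 + s))) n <= 1 + s^-1.
Proof.
move=> s0; case: n => [|n].
  by rewrite /series/= big_geq// addr_ge0// invr_ge0 ltW.
have powR_ltrn (k : nat) : s * (k.+2%:R : R) `^ (- (1 + s)) <= k.+1%:R `^ (- s) - k.+2%:R `^ (- s).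
  set x : R := k.+1%:R; set y : R := k.+2%:R.
  have x0 : 0 < x by rewrite ltr0n.
  have y0 : 0 < y by rewrite ltr0n.
  have yx : y = x + 1 by rewrite /y /x natr1.
  have y0' : y != 0 by rewrite gt_eqF.
  rewrite (_ : - (1 + s) = - s + - 1); last by ring.
  rewrite powRD ?y0' ?implybT// powR_inv1 ?(ltW y0)//.
  have -> : x `^ (- s) = (x / y) `^ (- s) * y `^ (- s).
    by rewrite -powRM ?divr_ge0 ?(ltW x0) ?(ltW y0)// divfK.
  (* Here [x / y = 1 - 1 / y]. Apply [1 + u <= exp u] to [u = - s ln (x / y)], then
     [ln (1 - 1 / y) <= - 1 / y]. *)
  have h1 : 1 + s / y <= (x / y) `^ (- s).
    have xy0 : 0 < x / y by rewrite divr_gt0.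
    rewrite /powR gt_eqF//; apply: le_trans (expR_ge1Dx _).
    have : ln (1 + (- y^-1)) <= - y^-1.
      by apply: le_ln1Dx; rewrite ltrN2 invf_lt1// yx ltrDr.
    have -> : 1 + - y^-1 = x / y.
      have -> : x = y - 1 by rewrite yx addrK.
      by field.
    move=> h; rewrite lerD2l mulNr -mulrN ler_pM2l// lerNr//.
  rewrite -[X in _ <= _ - X]mul1r -mulrBl mulrCA [leLHS]mulrC.
  by rewrite ler_wpM2r ?powR_ge0// lerBrDl.
have : series (fun k => k.+1%:R `^ (- (1 + s))) n.+1 <= 1 + s^-1 * (1 - n.+1%:R `^ (- s)).
  elim: n => [|n ih].
    by rewrite /series/= big_nat1 !powR1 subrr mulr0 addr0.
  rewrite {1}/series/= big_nat_recr//= -[X in X + _ <= _]/(series _ n.+1).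
  apply: (le_trans (lerD ih (lexx _))).
  rewrite -lerBrDl.
  have := powR_ltrn n; rewrite -ler_pdivlMl// => h.
  apply: (le_trans h).
  by rewrite -subr_ge0 (_ : _ - _ = 0)//; ring.
move=> /le_trans; apply; rewrite lerD2l ler_piMr ?invr_ge0 ?(ltW s0)//.
Qed.

Lemma is_cvg_series_natr_powR s : 0 < s ->
  cvgn (series (fun k => k.+1%:R `^ (- (1 + s)))).
Proof.
move=> s0; apply: nondecreasing_is_cvgn.
  by apply: nondecreasing_series => n _ _; exact: powR_ge0.
by exists (1 + s^-1) => _ [n _ <-]; exact: series_natr_powR_le.
Qed.

Lemma cvg_sum_from1 (f : nat -> R) (l : R) :
  series (fun n => f n.+1) @ \oo --> l ->
  \sum_(1 <= n < N) f n @[N --> \oo] --> l.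
Proof.
move=> h; rewrite -(cvg_shiftS (fun N => \sum_(1 <= n < N) f n)) /=.
by under eq_fun do rewrite big_add1 /=.
Qed.

Lemma lim_sum_from1 (f : nat -> R) (l : R) :
  series (fun n => f n.+1) @ \oo --> l ->
  \big[+%R/0]_(1 <= n <oo) f n = l.
Proof. by move=> /cvg_sum_from1/cvg_lim; apply. Qed.

End power_sums.

(** * Laplace transform of the kernel, and the case of exponent above 1 *)

Section Laplace_sum.
Context {R : realType}.
Notation mu := (@lebesgue_measure R).
Notation D0 := (`]0, +oo[%classic : set R).
Implicit Types (m r t : R).

Lemma measurable_cvg_countable (f : nat -> R -> R) (F : R -> R) (N : set R) : countable N ->
  (forall n, measurable_fun D0 (f n)) ->
  (forall t, 0 < t -> ~ N t -> f ^~ t @ \oo --> F t) -> measurable_fun D0 F.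
Proof.
move=> cN mf fF; apply: (measurable_fun_countable cN).
apply: (@measurable_fun_cvg _ _ _ _ f).
  by move=> n; apply: measurable_funS (mf n) => //; exact: subDsetl.
by move=> t [/=]; rewrite in_itv/= andbT; exact: fF.
Qed.

(** Measurability of [g] comes for free: off [N] it is the limit of the constant sequence [f]. *)
Lemma eq_has_integral_countable (f g : R -> R) (v : R) (N : set R) : countable N ->
  (forall t, 0 < t -> ~ N t -> f t = g t) ->
  has_integral f v -> has_integral g v.
Proof.
move=> cN fg hf; have mg : measurable_fun D0 g.
  apply: (@measurable_cvg_countable (fun=> f) g N) => //.
    by move=> _; exact: has_integral_measurable hf.
  by move=> t t0 Nt; rewrite fg//; exact: cvg_cst.
have [fi fv] := hf; have mf := measurable_int _ fi.
have meg : measurable_fun D0 (EFin \o g) by exact/measurable_EFinP.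
have N0 : mu N = 0%E by exact: countable_lebesgue_measure0.
have mN : measurable N by apply: countable_measurable => // t; exact: measurable_set1.
have ae : ae_eq mu D0 (EFin \o f) (EFin \o g).
  exists N; split => // t /= /not_implyP[]; rewrite in_itv/= andbT => t0 ft.
  by apply: contrapT => Nt; apply: ft; rewrite fg.
split; last by rewrite -fv; apply/esym; exact: ae_eq_integral.
apply/integrableP; split => //; have /integrableP[_] := fi.
have -> // : (\int[mu]_(x in D0) `|(EFin \o f) x| = \int[mu]_(x in D0) `|(EFin \o g) x|)%E.
apply: ae_eq_integral => //; [exact: measurableT_comp|exact: measurableT_comp|].
by apply: filterS ae => t ft Dt; exact: (congr1 abse (ft Dt)).
Qed.

Definition bessel_term_mathieu m (n : nat) t : R :=
  BesselJ (m + 1 / 2) (n.+1%:R * t) / n.+1%:R `^ (m - 1 / 2).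

Definition mathieu_coef m r (n : nat) : R :=
  2 * n.+1%:R / (n.+1%:R ^+ 2 + r ^+ 2) `^ (m + 1).

Lemma c_gt0 m : 1 <= m -> 0 < c_ m :> R.
Proof.
move=> m1; have g1 : 1 <= m + 1 by rewrite (le_trans m1)// lerDl.
by rewrite /c_ divr_gt0 ?sqrtr_gt0 ?pi_gt0// mulr_gt0 ?powR_gt0// Gamma_gt0.
Qed.

(** For [nu = m + 1/2] the exponent [nu + 1/2] is [m + 1]. The powers of the index, of exponents
    [nu] and [- (m - 1/2)], combine to the index itself, the numerator of the Mathieu term. *)
Lemma has_integral_mathieu_term m r (n : nat) : 1 <= m -> 0 < r ->
  has_integral (fun t => expR (- (r * t)) * (t `^ (m + 1 / 2) * bessel_term_mathieu m n t))
    ((c_ m)^-1 * mathieu_coef m r n).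
Proof.
move=> m1 r0; have m2 : 2^-1 <= m + 1 / 2 :> R by lra.
have n0 : 0 < n.+1%:R :> R by rewrite ltr0n.
have nu1 : m + 1 / 2 + 2^-1 = m + 1 :> R by field.
have g1 : 1 <= m + 1 by rewrite (le_trans m1)// lerDl.
have G0 : Gamma (m + 1) != 0 by rewrite gt_eqF// Gamma_gt0.
have := has_integralZ (n.+1%:R `^ (m - 1 / 2))^-1 (has_integral_laplace_BesselJ m2 n0 r0).
have -> : (n.+1%:R `^ (m - 1 / 2))^-1 *
   ((2 * n.+1%:R) `^ (m + 1 / 2) * Gamma (m + 1 / 2 + 2^-1) /
     (Num.sqrt pi * (n.+1%:R ^+ 2 + r ^+ 2) `^ (m + 1 / 2 + 2^-1))) =
   (c_ m)^-1 * mathieu_coef m r n.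
  rewrite nu1 /c_ /mathieu_coef powRM//.
  have -> : m + 1 / 2 = (m - 1 / 2) + 1 by field.
  rewrite (@powRD _ 2 (m - 1 / 2) 1) ?pnatr_eq0 ?implybT//.
  rewrite (@powRD _ n.+1%:R (m - 1 / 2) 1) ?pnatr_eq0 ?implybT// !powRr1//.
  have p0 : n.+1%:R `^ (m - 1 / 2) != 0 by rewrite gt_eqF// powR_gt0.
  have p2 : 2 `^ (m - 1 / 2) != 0 :> R by rewrite gt_eqF// powR_gt0.
  have spn : Num.sqrt pi != 0 :> R by rewrite gt_eqF// sqrtr_gt0 pi_gt0.
  have q0 : (n.+1%:R ^+ 2 + r ^+ 2) `^ (m + 1) != 0.
    by rewrite gt_eqF// powR_gt0// addr_gt0 ?exprn_gt0.
  move: ((n.+1%:R ^+ 2 + r ^+ 2) `^ (m + 1)) q0 (n.+1%:R `^ (m - 1 / 2)) p0 (2 `^ _) p2 (Num.sqrt _) spn (Gamma _) G0.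
  move=> a a0 b b0 d d0 e e0 f f0.
  by field; rewrite ?a0 ?b0 ?d0 ?e0 ?f0.
apply: eq_has_integral => t t0; rewrite /bessel_term_mathieu.
by move: (BesselJ _ _) (expR _) (_ `^ _) (t `^ _) => a b d e; ring.
Qed.

Lemma gen_mathieu_laplace m r I : 1 <= m ->
  has_integral (fun t => expR (- (r * t)) * K_ m t) I ->
  series (fun n => (c_ m)^-1 * mathieu_coef m r n) @ \oo --> I ->
  laplace_integrable (K_ m) r /\ gen_mathieu m r = c_ m * laplace (K_ m) r.
Proof.
move=> m1 hI hc; split; first exact: hI.1.
rewrite /laplace (has_integral_Rintegral hI).
apply: (lim_sum_from1 (f := fun n => 2 * n%:R / (n%:R ^+ 2 + r ^+ 2) `^ (m + 1))).
rewrite (_ : series _ = (fun n => c_ m * series (fun n => (c_ m)^-1 * mathieu_coef m r n) n)).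
  exact: cvgMr.
apply/funext => n; rewrite /series/= mulr_sumr; apply: eq_bigr => k _.
by rewrite mulVKf// gt_eqF// c_gt0.
Qed.

Lemma has_integral_K_gt1 m r : 1 < m -> 0 < r ->
  exists I, has_integral (fun t => expR (- (r * t)) * K_ m t) I /\
  series (fun n => (c_ m)^-1 * mathieu_coef m r n) @ \oo --> I.
Proof.
move=> m1 r0; have nu0 : 0 <= m + 1 / 2 by lra.
have [C HC] := BesselJ_decay nu0.
have m0 : 0 <= m by lra.
pose g (n : nat) t := C * n.+1%:R `^ (- m) * (t `^ m * expR (- (r * t))).
(* Bessel decay contributes the exponent -1/2 and the denominator [- (m - 1/2)]. The total [- m] is
   summable exactly for [m > 1]. *)
have term_le n t : 0 < t -> `|t `^ (m + 1 / 2) * bessel_term_mathieu m n t| <= C * n.+1%:R `^ (- m) * t `^ m.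
  move=> t0; have n0 : 0 < n.+1%:R :> R by rewrite ltr0n.
  have := @norm_powR_BesselJ R (m + 1 / 2) C t n.+1%:R t0 n0 HC.
  rewrite (_ : m + 1 / 2 - 2^-1 = m); last by field.
  move=> h; rewrite /bessel_term_mathieu mulrA normrM.
  apply: (le_trans (ler_wpM2r (normr_ge0 _) h)).
  rewrite normrV ?unitfE ?gt_eqF ?powR_gt0// (ger0_norm (powR_ge0 _ _)) -powRN.
  rewrite [X in X <= _](_ : _ = C * (n.+1%:R `^ (- 2^-1) * n.+1%:R `^ (- (m - 1 / 2))) * t `^ m); last by ring.
  rewrite -powRD ?pnatr_eq0 ?implybT//.
  by rewrite (_ : - 2^-1 + - (m - 1 / 2) = - m)//; field.
have cw : cvgn (series (fun n => n.+1%:R `^ (- m) : R)).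
  by have := @is_cvg_series_natr_powR R (m - 1); rewrite subr_gt0 addrC subrK; apply.
have cK t : 0 < t -> series (fun n => t `^ (m + 1 / 2) * bessel_term_mathieu m n t) @ \oo --> K_ m t.
  move=> t0; have tp : t `^ (m + 1 / 2) != 0 by rewrite gt_eqF// powR_gt0.
  have c1 : cvgn (series (fun n => t `^ (m + 1 / 2) * bessel_term_mathieu m n t)).
    apply: normed_cvg; apply: (@series_le_cvg _ _ (fun n => (C * t `^ m) * n.+1%:R `^ (- m))).
    - by move=> n; exact: normr_ge0.
    - move=> n; apply: le_trans (normr_ge0 _) _; last apply: (le_trans (term_le n t t0)).
      by rewrite mulrAC.
    - by move=> n; rewrite mulrAC; exact: term_le.
    - exact: is_cvg_seriesZ.
  have c2 : series (bessel_term_mathieu m ^~ t) @ \oo --> (t `^ (m + 1 / 2))^-1 * limn (series (fun n => t `^ (m + 1 / 2) * bessel_term_mathieu m n t)).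
    rewrite (_ : series (bessel_term_mathieu m ^~ t) = (fun n => (t `^ (m + 1 / 2))^-1 *
      series (fun n => t `^ (m + 1 / 2) * bessel_term_mathieu m n t) n)).
      exact: cvgMr.
    apply/funext => n; rewrite /series/= mulr_sumr; apply: eq_bigr => k _.
    by rewrite mulKf.
  have -> : K_ m t = limn (series (fun n => t `^ (m + 1 / 2) * bessel_term_mathieu m n t)).
    rewrite /K_ /g_ (lim_sum_from1 (f := fun n => BesselJ (m + 1 / 2) (n%:R * t) / n%:R `^ (m - 1 / 2)) c2).
    by rewrite mulVKf.
  exact: c1.
have mt n : measurable_fun D0 (fun t => t `^ (m + 1 / 2) * bessel_term_mathieu m n t).
  have := @measurable_powR_BesselJ R (m + 1 / 2) n.+1%:R (m + 1 / 2) nu0 (ltr0Sn _ _).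
  move=> /(measurable_funM)/(_ (measurable_cst (n.+1%:R `^ (m - 1 / 2))^-1)).
  apply: eq_measurable_fun => t _ /=.
  by rewrite /bessel_term_mathieu mulrA.
have mK : measurable_fun D0 (K_ m).
  apply: (@measurable_fun_cvg _ _ _ _ (fun k t => series (fun n => t `^ (m + 1 / 2) * bessel_term_mathieu m n t) k)).
    by move=> k; rewrite /series/=; exact: measurable_sum.
  by move=> t /=; rewrite in_itv/= andbT; exact: cK.
exists (\int[mu]_(t in D0) (expR (- (r * t)) * K_ m t)).
apply: (has_integral_series (f := fun n t => expR (- (r * t)) * (t `^ (m + 1 / 2) * bessel_term_mathieu m n t))
   (g := g) (N := set0) (w := fun n => C * n.+1%:R `^ (- m) * \int[mu]_(t in D0) (t `^ m * expR (- (r * t))))).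
- exact: countable0.
- apply: measurable_funM => //; apply: measurableT_comp => //; apply: measurable_funN.
  exact: mulrl_measurable.
- by move=> n; apply: has_integral_mathieu_term => //; exact: ltW.
- by move=> n; apply: has_integralZ; exact: has_integral_powR_expR.
- move=> n t t0; rewrite normrM (ger0_norm (expR_ge0 _)) mulrC /g mulrA.
  by apply: ler_wpM2r; [exact: expR_ge0|exact: term_le].
- set M := \int[mu]_(t in D0) _.
  rewrite (_ : (fun n => _) = (fun n => (C * M) * n.+1%:R `^ (- m))).
    exact: is_cvg_seriesZ.
  by apply/funext => n; rewrite mulrAC.
- move=> t t0 _.
  rewrite (_ : series _ = (fun k => expR (- (r * t)) * series (fun n => t `^ (m + 1 / 2) * bessel_term_mathieu m n t) k)).
    by apply: cvgMr; exact: cK.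
  by apply/funext => k; rewrite /series/= mulr_sumr.
Qed.

End Laplace_sum.

(** * The sine series h and the case mu = 1 *)

Section derivative_of_limit.
Context {R : realType}.

Lemma lipschitz_derive (f df : R -> R) (t e K x y : R) :
  (forall z : R, is_derive z 1 f (df z)) ->
  (forall z : R, `|z - t| < e -> `|df z| <= K) ->
  `|x - t| < e -> `|y - t| < e -> `|f y - f x| <= K * `|y - x|.
Proof.
move=> fdf dfK; wlog xy : x y / x <= y.
  move=> H xe ye; have [xy|/ltW yx] := leP x y; first exact: H.
  by rewrite distrC (distrC y); exact: H.
move=> xe ye; have cf z : {for z, continuous f}.
  by have [dz _] := fdf z; apply: differentiable_continuous; exact/derivable1_diffP.
have [|c cxy ->] := @MVT_segment R f df x y xy.
  by apply: continuous_subspaceT => z; exact: cf.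
rewrite normrM ler_wpM2r//; apply: dfK.
move: cxy xe ye; rewrite in_itv/= !ltr_norml => /andP[xc cy] /andP[xe1 xe2] /andP[ye1 ye2].
by rewrite (lt_le_trans xe1) ?lerD2r// (le_lt_trans _ ye2)// lerD2r.
Qed.

(** By the mean value theorem [F N - F M] is Lipschitz near [t] with constant [eps], uniformly in
    [N]. In the limit the difference quotients of [G] and [F M] differ by at most [eps]. *)
Lemma is_derive_lim (F f : nat -> R -> R) (G : R -> R) (g t e : R) : 0 < e ->
  (forall n (x : R), is_derive x 1 (F n) (f n x)) ->
  (forall x : R, F ^~ x @ \oo --> G x) ->
  (forall eps, 0 < eps -> exists M, forall N (x : R), (M <= N)%N -> `|x - t| < e ->
      `|f N x - f M x| <= eps) ->
  f ^~ t @ \oo --> g -> is_derive t 1 G g.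
Proof.
move=> e0 dF FG unif fg.
suff H : h^-1 *: (G (h *: 1 + t) - G t) @[h --> 0^'] --> g.
  split; first by apply/cvg_ex; exists g.
  exact: (cvg_lim _ H).
apply/cvgrPdist_le => eps eps0; have eps3 : 0 < eps / 3 by rewrite divr_gt0.
have [M HM] := unif _ eps3.
have te : `|t - t| < e by rewrite subrr normr0.
have gM : `|g - f M t| <= eps / 3.
  have c : `|f n t - f M t| @[n --> \oo] --> `|g - f M t|.
    by apply: cvg_norm; apply: cvgB => //; exact: cvg_cst.
  rewrite -(cvg_lim _ c)//; apply: limr_le; first by apply/cvg_ex; eexists; exact: c.
  by near=> n; apply: HM => //; near: n; exact: nbhs_infty_ge.
have dM : h^-1 *: (F M (h *: 1 + t) - F M t) @[h --> 0^'] --> f M t.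
  have [dFM <-] := dF M t; exact: dFM.
move/cvgrPdist_le : dM => /(_ _ eps3) dM.
near=> h.
have h0 : h != 0 by near: h; exact: nbhs_dnbhs_neq.
have he : `|h| < e.
  near: h; apply: dnbhs0_lt; exact: e0.
have hM : `|f M t - h^-1 *: (F M (h *: 1 + t) - F M t)| <= eps / 3 by near: h.
have lip : `|(G (h *: 1 + t) - F M (h *: 1 + t)) - (G t - F M t)| <= eps / 3 * `|h|.
  have c : `|(F n (h *: 1 + t) - F M (h *: 1 + t)) - (F n t - F M t)| @[n --> \oo] -->
     `|(G (h *: 1 + t) - F M (h *: 1 + t)) - (G t - F M t)|.
    apply: cvg_norm; apply: cvgB; (apply: cvgB; [exact: FG|exact: cvg_cst]).
  rewrite -(cvg_lim _ c)//; apply: limr_le; first by apply/cvg_ex; eexists; exact: c.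
  near=> n; have Mn : (M <= n)%N by near: n; exact: nbhs_infty_ge.
  have -> : `|h| = `|(h *: 1 + t) - t| by rewrite addrK /GRing.scale/= mulr1.
  apply: (@lipschitz_derive (fun x => F n x - F M x) (fun x => f n x - f M x) t e) => //.
  - by move=> z; exact: HM.
  - by rewrite addrK /GRing.scale/= mulr1.
have -> : g - h^-1 *: (G (h *: 1 + t) - G t) =
   (g - f M t) + (f M t - h^-1 *: (F M (h *: 1 + t) - F M t)) -
   h^-1 * ((G (h *: 1 + t) - F M (h *: 1 + t)) - (G t - F M t)).
  by rewrite /GRing.scale/=; ring.
have -> : eps = eps / 3 + eps / 3 + eps / 3 by field.
apply: (le_trans (ler_normB _ _)); apply: lerD.
  by apply: (le_trans (ler_normD _ _)); exact: lerD.
by rewrite normrM normfV mulrC ler_pdivrMr ?normr_gt0.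
Unshelve. all: by end_near. Qed.

End derivative_of_limit.

(** * Cosine sums and the derivative of the sine series *)

Section trigonometric_sums.
Context {R : realType}.
Implicit Types (t x y S : R).

Definition cos_sum (n : nat) t : R := \sum_(0 <= k < n) cos (k.+1%:R * t).

Definition cos_div_sum (n : nat) t : R := \sum_(0 <= k < n) (cos (k.+1%:R * t) / k.+1%:R).

Definition sin_div_sum (n : nat) t : R :=
  \sum_(0 <= k < n) (sin (k.+1%:R * t) / k.+1%:R ^+ 2).

(** Summation by parts. Dividing the boundary term by [n.+1] rather than [n] makes the identity hold
    from [n = 0] on. *)
Lemma cos_div_sum_abel (n : nat) t : cos_div_sum n t = cos_sum n t / n.+1%:R +
  \sum_(0 <= k < n) (cos_sum k.+1 t / (k.+1%:R * k.+2%:R)).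
Proof.
elim: n => [|n ih]; first by rewrite /cos_div_sum /cos_sum !big_geq// mul0r addr0.
rewrite /cos_div_sum big_nat_recr//= -/(cos_div_sum n t) ih [in RHS]big_nat_recr//=.
have -> : cos_sum n.+1 t = cos_sum n t + cos (n.+1%:R * t).
  by rewrite /cos_sum big_nat_recr.
have n0 : n.+1%:R != 0 :> R by rewrite pnatr_eq0.
have n1 : n.+1%:R + 1 != 0 :> R by rewrite natr1 pnatr_eq0.
rewrite -[n.+2%:R]natr1.
set sm := \sum_(0 <= k < n) _; set d : R := n.+1%:R in n0 n1 *.
move: (cos _) (cos_sum _ _) => a b; clearbody d sm.
by field; rewrite ?n0 ?n1.
Qed.

(** The Dirichlet kernel: multiplied by [2 sin (t / 2)], the sum telescopes. *)
Lemma sin_half_cos_sum (n : nat) t :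
  2 * sin (t / 2) * cos_sum n t = sin (n%:R * t + t / 2) - sin (t / 2).
Proof.
elim: n => [|n ih]; first by rewrite /cos_sum big_geq// mulr0 mul0r add0r subrr.
rewrite /cos_sum big_nat_recr//= -/(cos_sum n t) mulrDr ih.
have -> : n%:R * t + t / 2 = n.+1%:R * t - t / 2 by rewrite -natr1; field.
rewrite sinB sinD.
by move: (sin _) (cos _) (sin _) (cos _) => a b c d; ring.
Qed.

Lemma norm_cos_sum (n : nat) t : sin (t / 2) != 0 -> `|cos_sum n t| <= `|sin (t / 2)|^-1.
Proof.
move=> s0; have sp : 0 < `|sin (t / 2)| by rewrite normr_gt0.
rewrite -[leRHS]mul1r ler_pdivlMr// -(@ler_pM2l _ 2)// mulr1.
have -> : 2 * (`|cos_sum n t| * `|sin (t / 2)|) = `|sin (n%:R * t + t / 2) - sin (t / 2)|.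
  by rewrite -sin_half_cos_sum !normrM (ger0_norm (ler0n _ 2)); ring.
apply: (le_trans (ler_normB _ _)).
by rewrite [leRHS](_ : 2 = 1 + 1)// lerD// sin_max.
Qed.

Lemma norm_cos_sum_le (n : nat) t : `|cos_sum n t| <= n%:R.
Proof.
apply: (le_trans (ler_norm_sum _ _ _)).
apply: (@le_trans _ _ (\sum_(0 <= k < n) 1)).
  by apply: ler_sum => k _; exact: cos_max.
by rewrite sumr_const_nat subn0.
Qed.

Lemma norm_cos_div_sum (n : nat) t : `|cos_div_sum n t| <=
  1 + \sum_(0 <= k < n) (`|cos_sum k.+1 t| / (k.+1%:R * k.+2%:R)).
Proof.
rewrite cos_div_sum_abel; apply: (le_trans (ler_normD _ _)); apply: lerD.
  rewrite normrM normfV (ger0_norm (ler0n _ _)) ler_pdivrMr// mul1r.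
  by rewrite (le_trans (norm_cos_sum_le _ _))// ler_nat.
apply: (le_trans (ler_norm_sum _ _ _)); apply: ler_sum => k _.
by rewrite normrM normfV [X in _ / X]ger0_norm// mulr_ge0.
Qed.

(** A quantitative Dirichlet test, depending on [t] only through [S]; this supplies the uniformity
    that [is_derive_lim] asks for. The two boundary terms and the telescoping tail add up to
    [2 S / (M + 1)]. *)
Lemma cos_div_sum_cauchy S (M N : nat) t : (forall n, `|cos_sum n t| <= S) -> (M <= N)%N ->
  `|cos_div_sum N t - cos_div_sum M t| <= 2 * S / M.+1%:R.
Proof.
move=> DS /subnKC <-; move: (N - M)%N => j {N}.
have S0 : 0 <= S by exact: le_trans (normr_ge0 _) (DS 0%N).
pose A n := \sum_(0 <= k < n) (cos_sum k.+1 t / (k.+1%:R * k.+2%:R)).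
have HA : `|A (M + j)%N - A M| <= S * (M.+1%:R^-1 - (M + j).+1%:R^-1).
  elim: j => [|j ih]; first by rewrite addn0 !subrr normr0 mulr0.
  rewrite addnS /A big_nat_recr//= -/(A _) addrAC.
  apply: (le_trans (ler_normD _ _)).
  apply: (le_trans (lerD ih (lexx _))).
  rewrite normrM normfV [X in _ / X]ger0_norm ?mulr_ge0//.
  apply: (le_trans (lerD (lexx _) (ler_wpM2r _ (DS _)))).
    by rewrite invr_ge0 mulr_ge0.
  rewrite -[(M + j).+2%:R]natr1.
  have n0 : (M + j).+1%:R != 0 :> R by rewrite pnatr_eq0.
  have n1 : (M + j).+1%:R + 1 != 0 :> R by rewrite natr1 pnatr_eq0.
  move: (M.+1%:R^-1 : R) ((M + j).+1%:R : R) n0 n1 => a d d0 d1.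
  have -> : S * (a - d^-1) + S / (d * (d + 1)) = S * (a - (d + 1)^-1) by field; rewrite d0 d1.
  exact: lexx.
have Hd n : `|cos_sum n t / n.+1%:R| <= S / n.+1%:R.
  by rewrite normrM normfV (ger0_norm (ler0n _ _)) ler_wpM2r ?invr_ge0.
rewrite !cos_div_sum_abel -!/(A _).
have -> : cos_sum (M + j) t / (M + j).+1%:R + A (M + j)%N - (cos_sum M t / M.+1%:R + A M) =
   cos_sum (M + j) t / (M + j).+1%:R + (A (M + j)%N - A M) - cos_sum M t / M.+1%:R by ring.
apply: (le_trans (ler_normB _ _)); apply: (le_trans (lerD (ler_normD _ _) (lexx _))).
apply: (le_trans (lerD (lerD (Hd _) HA) (Hd _))).
by rewrite -subr_ge0 (_ : _ - _ = 0)//; ring.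
Qed.

Lemma is_cvg_cos_div_sum t : sin (t / 2) != 0 -> cvgn (cos_div_sum ^~ t).
Proof.
move=> s0; have DS n := norm_cos_sum n s0.
set S := `|_|^-1 in DS; have S0 : 0 <= S by rewrite invr_ge0.
have c1 : cos_sum n t / n.+1%:R @[n --> \oo] --> 0.
  apply: (@squeeze_cvgr _ _ _ _ (fun n => - (S * (@harmonic R) n)) (fun n => S * (@harmonic R) n)).
  - near=> n; rewrite -ler_norml normrM normfV (ger0_norm (ler0n _ _)) /harmonic/=.
    by rewrite ler_wpM2r ?invr_ge0.
  - by rewrite -oppr0 -(mulr0 S); apply: cvgN; apply: cvgMr; exact: cvg_harmonic.
  - by rewrite -(mulr0 S); apply: cvgMr; exact: cvg_harmonic.
have c2 : cvgn (series (fun k => cos_sum k.+1 t / (k.+1%:R * k.+2%:R))).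
  apply: normed_cvg; apply: (@series_le_cvg _ _ (fun k => S * k.+1%:R `^ (- (1 + 1)))).
  - by move=> k; exact: normr_ge0.
  - by move=> k; rewrite mulr_ge0 ?powR_ge0.
  - move=> k /=; rewrite normrM normfV [X in _ / X]ger0_norm ?mulr_ge0//.
    rewrite ler_pM ?invr_ge0 ?mulr_ge0// (_ : - (1 + 1) = - 2%:R)// powR_invn//.
    by rewrite lef_pV2 ?posrE ?mulr_gt0 ?exprn_gt0// expr2 ler_pM2l// ler_nat.
  - by apply: is_cvg_seriesZ; exact: is_cvg_series_natr_powR.
apply/cvg_ex; eexists.
rewrite (_ : cos_div_sum ^~ t = (fun n => cos_sum n t / n.+1%:R + series (fun k => cos_sum k.+1 t / (k.+1%:R * k.+2%:R)) n)).
  by apply: cvgD; [exact: c1|exact: c2].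
by apply/funext => n; rewrite cos_div_sum_abel.
Unshelve. all: by end_near. Qed.

Lemma is_cvg_sin_div_sum t : cvgn (sin_div_sum ^~ t).
Proof.
apply: (@normed_cvg _ _ (fun k => sin (k.+1%:R * t) / k.+1%:R ^+ 2)).
apply: (@series_le_cvg _ _ (fun k => k.+1%:R `^ (- (1 + 1)))).
- by move=> k; exact: normr_ge0.
- by move=> k; exact: powR_ge0.
- move=> k /=; rewrite (_ : - (1 + 1) = - 2%:R)// powR_invn// normrM normfV.
  rewrite [X in _ / X]ger0_norm ?exprn_ge0// -[leRHS]mul1r.
  by apply: ler_wpM2r; [rewrite invr_ge0 exprn_ge0|exact: sin_max].
- exact: is_cvg_series_natr_powR.
Qed.

Lemma cvg_h t : sin_div_sum ^~ t @ \oo --> h t.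
Proof.
have c := @is_cvg_sin_div_sum t.
by rewrite /h (lim_sum_from1 (f := fun n => sin (n%:R * t) / n%:R ^+ 2) c).
Qed.

Lemma is_derive_sin_div_sum (n : nat) x : is_derive x 1 (sin_div_sum n) (cos_div_sum n x).
Proof.
elim: n => [|n ih].
  rewrite (_ : sin_div_sum 0 = cst 0); last by apply/funext => y; rewrite /sin_div_sum big_geq.
  by rewrite /cos_div_sum big_geq//; exact: is_derive_cst.
rewrite (_ : sin_div_sum n.+1 = (fun y => sin_div_sum n y + n.+1%:R ^- 2 * sin (n.+1%:R * y))); last first.
  by apply/funext => y; rewrite /sin_div_sum big_nat_recr//= [in RHS]mulrC.
rewrite /cos_div_sum big_nat_recr//= -/(cos_div_sum n x).
apply: is_derive_eq; rewrite /GRing.scale/= mulr1.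
have n0 : n.+1%:R != 0 :> R by rewrite pnatr_eq0.
set b : R := n.+1%:R in n0 *; clearbody b; by move: (cos _) => a; field.
Qed.

Lemma is_derive_h t : sin (t / 2) != 0 ->
  is_derive t 1 (@h R) (limn (cos_div_sum ^~ t)).
Proof.
(* Half the value at [t]: by continuity a lower bound on a whole neighbourhood, where [sg^-1] then
   bounds all cosine sums. *)
move=> s0; pose sg := `|sin (t / 2)| / 2.
have sg0 : 0 < sg by rewrite divr_gt0// normr_gt0.
have cs : {for t, continuous (fun x => `|sin (x / 2)|)}.
  apply: cvg_norm; apply: (@continuous_comp _ _ _ (fun x : R => x / 2) sin).
    by apply: cvgM; [exact: cvg_id|exact: cvg_cst].
  exact: continuous_sin.
have [e /= e0 He] : \forall x \near t, sg < `|sin (x / 2)|.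
  apply: (cvgr_gt _ cs); rewrite /sg ltr_pdivrMr// mulr_natr mulr2n ltrDl normr_gt0//.
have HS x : `|x - t| < e -> forall n, `|cos_sum n x| <= sg^-1.
  move=> xt n; have sx : sg < `|sin (x / 2)| by apply: He; rewrite /ball_ /= distrC.
  apply: (le_trans (norm_cos_sum _ _)); first by rewrite -normr_gt0 (lt_trans sg0).
  by rewrite (lef_pV2 (lt_trans sg0 sx) sg0) ltW.
apply: (@is_derive_lim _ sin_div_sum cos_div_sum _ _ t e) => //.
- exact: is_derive_sin_div_sum.
- exact: cvg_h.
- move=> eps eps0; have [M HM] : exists M : nat, 2 * sg^-1 / M.+1%:R <= eps.
    exists (Num.truncn (2 * sg^-1 / eps)); rewrite ler_pdivrMr// [leRHS]mulrC -ler_pdivrMr//.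
    exact/ltW/Num.Theory.truncnS_gt.
  exists M => N x MN /HS xt; exact: le_trans (cos_div_sum_cauchy xt MN) HM.
- exact: is_cvg_cos_div_sum.
Qed.

Lemma countable_sin_half_eq0 : countable [set t : R | 0 < t /\ sin (t / 2) = 0].
Proof.
apply: sub_countable (countableP (setT : set nat)).
apply: card_le_trans (card_image_le (fun k : nat => k%:R * pi *+ 2) setT).
apply: subset_card_le => t [t0 st]; pose x := t / 2.
have x0 : 0 < x by rewrite divr_gt0.
have pi0 : 0 < pi :> R by exact: pi_gt0.
(* Subtracting [k pi] moves [x = t / 2] into the interval from 0 to [pi], where the sine vanishes
   only at the left end; hence [t = 2 k pi]. *)
pose k := Num.truncn (x / pi); exists k => //.
have /andP[k1 k2] : k%:R <= x / pi < k.+1%:R.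
  by apply: Num.Theory.truncn_itv; rewrite divr_ge0// ltW.
have y0 : 0 <= x - k%:R * pi by rewrite subr_ge0 -ler_pdivlMr.
have y1 : x - k%:R * pi < pi.
  by rewrite ltrBlDr -[X in X + _]mul1r -mulrDl addrC natr1 -ltr_pdivrMr.
have sx : sin (x - k%:R * pi) = 0.
  have := alternatingn (@sinDpi R) k (x - k%:R * pi).
  rewrite -[pi *+ k]mulr_natl subrK -/x st => /esym/eqP; rewrite mulf_eq0 expf_eq0 oppr_eq0 oner_eq0 andbF /=.
  by move/eqP.
have [y00|] := eqVneq (x - k%:R * pi) 0.
  have : x = k%:R * pi by apply/eqP; rewrite -subr_eq0 y00.
  by rewrite /x => e; rewrite -e mulr2n; field.
move=> yn; have yp : 0 < x - k%:R * pi by rewrite lt_neqAle eq_sym yn y0.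
by have := @sin_gt0_pi R (x - k%:R * pi); rewrite yp y1 sx ltxx => /(_ isT).
Qed.

End trigonometric_sums.

(** * Weighted mean square of the cosine sums *)

Section mean_square.
Context {R : realType}.
Notation mu := (@lebesgue_measure R).
Notation D0 := (`]0, +oo[%classic : set R).
Implicit Types (a b d t x y : R).

Lemma measurable_cosM b : measurable_fun D0 (fun t => cos (b * t)).
Proof.
apply: continuous_measurable_D0 => x _; apply: (@continuous_comp _ _ _ (fun t => b * t) cos).
  by apply: cvgM; [exact: cvg_cst|exact: cvg_id].
exact: continuous_cos.
Qed.

Lemma measurable_expRNM a : measurable_fun D0 (fun t => expR (- (a * t))).
Proof.
apply: measurableT_comp => //; apply: measurable_funN; exact: mulrl_measurable.
Qed.

Lemma has_integral_expR_cos a b : 0 < a ->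
  has_integral (fun t => expR (- (a * t)) * cos (b * t)) (a / (a ^+ 2 + b ^+ 2)).
Proof.
move=> a0; have s0 : 0 < a ^+ 2 + b ^+ 2 by rewrite ltr_wpDr ?sqr_ge0// exprn_gt0.
have sn : a ^+ 2 + b ^+ 2 != 0 by rewrite gt_eqF.
have hE := has_integral_expR a0.
have hI : has_integral (fun t => expR (- (a * t)) * cos (b * t))
   (\int[mu]_(t in D0) (expR (- (a * t)) * cos (b * t))).
  apply: (has_integral_le_norm _ _ hE).
    by apply: measurable_funM; [exact: measurable_expRNM|exact: measurable_cosM].
  move=> t _; rewrite normrM (ger0_norm (expR_ge0 _)) -[leRHS]mulr1.
  by apply: ler_wpM2l; [exact: expR_ge0|exact: cos_max].
have cE x : {for x, continuous (fun t => expR (- (a * t)))}.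
  apply: (@continuous_comp _ _ _ (fun t => - (a * t)) expR); last exact: continuous_expR.
  by apply: cvgN; apply: cvgM; [exact: cvg_cst|exact: cvg_id].
have cC x : {for x, continuous (fun t => cos (b * t))}.
  apply: (@continuous_comp _ _ _ (fun t => b * t) cos); last exact: continuous_cos.
  by apply: cvgM; [exact: cvg_cst|exact: cvg_id].
have cS x : {for x, continuous (fun t => sin (b * t))}.
  apply: (@continuous_comp _ _ _ (fun t => b * t) sin); last exact: continuous_sin.
  by apply: cvgM; [exact: cvg_cst|exact: cvg_id].
pose F t := (a ^+ 2 + b ^+ 2)^-1 * (expR (- (a * t)) * (b * sin (b * t) - a * cos (b * t))).
suff e : \int[mu]_(t in D0) (expR (- (a * t)) * cos (b * t)) = 0 - (- (a / (a ^+ 2 + b ^+ 2))).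
  by move: hI; rewrite e sub0r opprK.
apply: (has_integral_primitive (F := F) hI).
- by move=> x _; apply: cvgM; [exact: cE|exact: cC].
- move=> x _; rewrite /F; apply: is_derive_eq; rewrite /GRing.scale/=.
  by move: (expR _) (cos _) (sin _) => u v w; field.
- have : F t @[t --> 0^'+] --> F 0.
    apply: cvg_at_right_filter; apply: cvgMr; apply: cvgM; first exact: cE.
    by apply: cvgB; apply: cvgMr; [exact: cS|exact: cC].
  rewrite {2}/F !mulr0 oppr0 expR0 sin0 cos0 mulr0 sub0r mulr1 mul1r mulrN.
  by rewrite [_^-1 * a]mulrC.
- have cy : expR (- (a * t)) @[t --> +oo] --> 0.
    apply: (@cvg_comp _ _ _ (fun t => a * t) (fun t => expR (- t)) _ (pinfty_nbhs R)); last exact: cvgr_expR.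
    exact: gt0_cvgMry.
  pose B := (a ^+ 2 + b ^+ 2)^-1 * (`|b| + a).
  have cB : B * expR (- (a * t)) @[t --> +oo] --> 0.
    by rewrite -[X in _ --> X](mulr0 B); apply: cvgMr.
  apply/norm_cvg0P; apply: (squeeze_cvgr _ (cvg_cst 0) cB).
  near=> t; rewrite normr_ge0 /F normrM (ger0_norm _) ?invr_ge0 ?(ltW s0)//.
  rewrite /B -mulrA; apply: ler_wpM2l; first by rewrite invr_ge0 ltW.
  rewrite normrM (ger0_norm (expR_ge0 _)) mulrC; apply: ler_wpM2r; first exact: expR_ge0.
  apply: (le_trans (ler_normB _ _)); rewrite !normrM; apply: lerD.
    by rewrite ler_piMr ?sin_max.
  by rewrite (ger0_norm (ltW a0)) ler_piMr ?cos_max// ltW.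
Unshelve. all: by end_near. Qed.

Lemma cosMcos x y : cos x * cos y = 2^-1 * (cos (x - y) + cos (x + y)).
Proof. by rewrite cosB cosD; field. Qed.

Lemma has_integral_expR_coscos a b d : 0 < a ->
  has_integral (fun t => expR (- (a * t)) * (cos (b * t) * cos (d * t)))
    (2^-1 * (a / (a ^+ 2 + (b - d) ^+ 2) + a / (a ^+ 2 + (b + d) ^+ 2))).
Proof.
move=> a0; have := has_integralZ 2^-1 (has_integralD
   (has_integral_expR_cos (b - d) a0) (has_integral_expR_cos (b + d) a0)).
apply: eq_has_integral => t _; rewrite cosMcos mulrBl mulrDl.
by move: (expR _) (cos _) (cos _) => u v w; ring.
Qed.

(** Both denominators are at least [(b - d) ^ 2]. For integer frequencies this is summable over [d],
    uniformly in [b]. *)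
Lemma coscos_value_le a b d : 0 < a -> 0 <= d -> d < b ->
  2^-1 * (a / (a ^+ 2 + (b - d) ^+ 2) + a / (a ^+ 2 + (b + d) ^+ 2)) <= a / (b - d) ^+ 2.
Proof.
move=> a0 d0 db; have bd : 0 < b - d by rewrite subr_gt0.
have H x : b - d <= x -> a / (a ^+ 2 + x ^+ 2) <= a / (b - d) ^+ 2.
  move=> bx; have x0 : 0 < x by exact: lt_le_trans bx.
  apply: ler_wpM2l; first exact: ltW.
  have p1 : 0 < a ^+ 2 + x ^+ 2 by rewrite addr_gt0 ?exprn_gt0.
  have p2 : 0 < (b - d) ^+ 2 by rewrite exprn_gt0.
  rewrite (lef_pV2 p1 p2).
  apply: (@le_trans _ _ (x ^+ 2)); last by rewrite lerDr sqr_ge0.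
  by rewrite ler_sqr ?nnegrE ?(ltW bd) ?(ltW x0).
have h1 := H _ (lexx _); have h2 : a / (a ^+ 2 + (b + d) ^+ 2) <= a / (b - d) ^+ 2.
  by apply: H; lra.
by move: h1 h2; move: (a / (_ + (b - d) ^+ 2)) (a / (_ + (b + d) ^+ 2)) (a / (b - d) ^+ 2) => u v w; lra.
Qed.

Lemma sum_inv_sqr_sub (n : nat) : \sum_(0 <= k < n) ((n.+1%:R - k.+1%:R) ^+ 2)^-1 <= 2 :> R.
Proof.
rewrite big_nat_rev/= add0n.
rewrite (eq_big_nat _ _ (F2 := fun k => k.+1%:R `^ (- (1 + 1)))); last first.
  move=> i /andP[_ ni]; rewrite (_ : - (1 + 1) = - 2%:R)// powR_invn// -natrB ?ltnS ?leq_subr//.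
  by rewrite subSS subKn.
by have := @series_natr_powR_le R 1 n ltr01; rewrite invr1 (_ : 1 + 1 = 2).
Qed.

(* Near-orthogonality of the cosines for the weight [exp (- a t)]. *)
Lemma has_integral_cos_sum_sqr a (n : nat) : 0 < a ->
  exists2 I, has_integral (fun t => expR (- (a * t)) * cos_sum n t ^+ 2) I &
    I <= n%:R * (4 * a + a^-1).
Proof.
move=> a0; elim: n => [|n [I hI IB]].
  exists 0; last by rewrite mul0r.
  apply: eq_has_integral has_integral0 => t _.
  by rewrite /cos_sum big_geq// expr0n mulr0.
pose Q b d := 2^-1 * (a / (a ^+ 2 + (b - d) ^+ 2) + a / (a ^+ 2 + (b + d) ^+ 2)).
have h1 : has_integral (fun t => \sum_(0 <= k < n) (expR (- (a * t)) * (cos (n.+1%:R * t) * cos (k.+1%:R * t))))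
   (\sum_(0 <= k < n) Q n.+1%:R k.+1%:R).
  by apply: has_integral_sum => k; exact: has_integral_expR_coscos.
have h2 := has_integral_expR_coscos n.+1%:R n.+1%:R a0.
(* Expansion of the square of [cos_sum n.+1 t]. The cross terms add at most [4 a] and the diagonal
   one at most [a^-1], which is the increment in the bound. *)
exists (I + 2 * (\sum_(0 <= k < n) Q n.+1%:R k.+1%:R) + Q n.+1%:R n.+1%:R).
  apply: eq_has_integral (has_integralD (has_integralD hI (has_integralZ 2 h1)) h2) => t _.
  have -> : cos_sum n.+1 t = cos_sum n t + cos (n.+1%:R * t).
    by rewrite /cos_sum big_nat_recr.
  rewrite -mulr_sumr -mulr_sumr -/(cos_sum n t).
  by move: (expR _) (cos_sum _ _) (cos _) => u v w; ring.
have q1 : \sum_(0 <= k < n) Q n.+1%:R k.+1%:R <= 2 * a.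
  apply: (@le_trans _ _ (a * \sum_(0 <= k < n) ((n.+1%:R - k.+1%:R) ^+ 2)^-1)).
    rewrite mulr_sumr !big_nat; apply: ler_sum => k /andP[_ kn].
    by apply: coscos_value_le => //; rewrite ltr_nat ltnS.
  by rewrite mulrC ler_wpM2r ?sum_inv_sqr_sub// ltW.
have q2 : Q n.+1%:R n.+1%:R <= a^-1.
  have an : a != 0 by rewrite gt_eqF.
  rewrite /Q subrr expr0n addr0.
  have -> : a / a ^+ 2 = a^-1 by field.
  have : a / (a ^+ 2 + (n.+1%:R + n.+1%:R) ^+ 2) <= a^-1.
    rewrite ler_pdivrMr ?ltr_wpDr ?sqr_ge0 ?exprn_gt0//.
    have -> : a^-1 * (a ^+ 2 + (n.+1%:R + n.+1%:R) ^+ 2) = a + a^-1 * (n.+1%:R + n.+1%:R) ^+ 2 by field.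
    by rewrite lerDl mulr_ge0 ?sqr_ge0// invr_ge0 ltW.
  by move: (a / _) (a^-1) => u v; lra.
apply: (le_trans (lerD (lerD IB (ler_wpM2l (ler0n _ 2) q1)) q2)).
by rewrite -subr_ge0 (_ : _ - _ = 0)//; rewrite -natr1; ring.
Qed.

End mean_square.

(** * The kernel of exponent 1 *)

Section mathieu_series.
Context {R : realType}.
Notation mu := (@lebesgue_measure R).
Notation D0 := (`]0, +oo[%classic : set R).
Implicit Types (a b d t x y r : R).

Lemma bessel_term_mathieu1 (n : nat) t : 0 < t ->
  t `^ (1 + 1 / 2) * bessel_term_mathieu 1 n t =
  Num.sqrt (2 / pi) * (sin (n.+1%:R * t) / n.+1%:R ^+ 2 - t * (cos (n.+1%:R * t) / n.+1%:R)).
Proof.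
move=> t0; have n0 : 0 < n.+1%:R :> R by rewrite ltr0n.
have nt0 : 0 < n.+1%:R * t by rewrite mulr_gt0.
have nn : n.+1%:R != 0 :> R by rewrite gt_eqF.
have := BesselJ32 nt0; rewrite powRM ?(ltW n0) ?(ltW t0)// => h.
have e : n.+1%:R `^ (1 + 1 / 2) = n.+1%:R ^+ 2 / n.+1%:R `^ (1 - 1 / 2) :> R.
  rewrite -powR_mulrn// -powRB ?nn ?implybT//; congr (_ `^ _); by field.
rewrite /bessel_term_mathieu.
have -> : t `^ (1 + 1 / 2) * (BesselJ (1 + 1 / 2) (n.+1%:R * t) / n.+1%:R `^ (1 - 1 / 2)) =
    n.+1%:R ^- 2 * (n.+1%:R `^ (1 + 1 / 2) * t `^ (1 + 1 / 2) * BesselJ (1 + 1 / 2) (n.+1%:R * t)).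
  rewrite e; have p0 : n.+1%:R `^ (1 - 1 / 2) != 0 :> R by rewrite gt_eqF// powR_gt0.
  move: (BesselJ _ _) (t `^ _) (_ `^ (1 - 1 / 2)) p0 => u v w w0.
  set k : R := n.+1%:R in nn *; clearbody k; by field; rewrite w0 nn.
rewrite h; set k : R := n.+1%:R in nn *; clearbody k.
by move: (sin _) (cos _) (Num.sqrt _) => u v w; field.
Qed.

Lemma series_mathieu_term1 r (n : nat) t : 0 < t ->
  series (fun n => expR (- (r * t)) * (t `^ (1 + 1 / 2) * bessel_term_mathieu 1 n t)) n =
  expR (- (r * t)) * (Num.sqrt (2 / pi) * (sin_div_sum n t - t * cos_div_sum n t)).
Proof.
move=> t0; rewrite /series/= -mulr_sumr; congr (_ * _).
under eq_bigr do rewrite bessel_term_mathieu1//.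
by rewrite -mulr_sumr sumrB -mulr_sumr.
Qed.

Lemma norm_sin_div_sum (n : nat) t :
  `|sin_div_sum n t| <= \sum_(0 <= k < n) k.+1%:R `^ (- (1 + 1)).
Proof.
apply: (le_trans (ler_norm_sum _ _ _)); apply: ler_sum => k _.
rewrite (_ : - (1 + 1) = - 2%:R)// powR_invn// normrM normfV.
rewrite [X in _ / X]ger0_norm ?exprn_ge0// -[leRHS]mul1r.
by apply: ler_wpM2r; [rewrite invr_ge0 exprn_ge0|exact: sin_max].
Qed.

Lemma cvg_K1 t : 0 < t -> sin (t / 2) != 0 ->
  Num.sqrt (2 / pi) * (sin_div_sum n t - t * cos_div_sum n t) @[n --> \oo] --> K_ 1 t.
Proof.
move=> t0 s0; have tp : t `^ (1 + 1 / 2) != 0 by rewrite gt_eqF// powR_gt0.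
have c1 : Num.sqrt (2 / pi) * (sin_div_sum n t - t * cos_div_sum n t) @[n --> \oo] -->
   Num.sqrt (2 / pi) * (h t - t * limn (cos_div_sum ^~ t)).
  apply: cvgMr; apply: cvgB; first exact: cvg_h.
  by apply: cvgMr; exact: is_cvg_cos_div_sum.
suff -> : K_ 1 t = Num.sqrt (2 / pi) * (h t - t * limn (cos_div_sum ^~ t)) by [].
set L := Num.sqrt _ * _ in c1 *.
have c2 : series (bessel_term_mathieu 1 ^~ t) @ \oo --> (t `^ (1 + 1 / 2))^-1 * L.
  rewrite (_ : series (bessel_term_mathieu 1 ^~ t) = (fun n => (t `^ (1 + 1 / 2))^-1 *
     (Num.sqrt (2 / pi) * (sin_div_sum n t - t * cos_div_sum n t)))); first exact: cvgMr.
  apply/funext => n; have := series_mathieu_term1 0 n t0.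
  rewrite mul0r oppr0 expR0 [RHS]mul1r => <-.
  rewrite /series/= mulr_sumr; apply: eq_bigr => k _.
  by rewrite [1 * (_ * _)]mul1r mulKf.
rewrite /K_ /g_ (lim_sum_from1 (f := fun n => BesselJ (1 + 1 / 2) (n%:R * t) / n%:R `^ (1 - 1 / 2)) c2).
by rewrite mulVKf.
Qed.

Lemma K_eq_K1 t : sin (t / 2) != 0 -> 0 < t -> K t = c_ 1 * K_ 1 t.
Proof.
move=> s0 t0; have := is_derive_h s0.
rewrite /K derive1E => -[_ ->].
have c1 : Num.sqrt (2 / pi) * (sin_div_sum n t - t * cos_div_sum n t) @[n --> \oo] -->
   Num.sqrt (2 / pi) * (h t - t * limn (cos_div_sum ^~ t)).
  apply: cvgMr; apply: cvgB; first exact: cvg_h.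
  by apply: cvgMr; exact: is_cvg_cos_div_sum.
have -> : K_ 1 t = Num.sqrt (2 / pi) * (h t - t * limn (cos_div_sum ^~ t)).
  exact: cvg_unique (cvg_K1 t0 s0) c1.
have -> : c_ 1 = (Num.sqrt (2 / pi))^-1 :> R.
  rewrite /c_ GammaS// Gamma1 mulr1 mulr1 (_ : 1 - 1 / 2 = 2^-1); last by field.
  by rewrite powR12_sqrt// sqrtrM// sqrtrV ?pi_ge0// invfM invrK mulrC.
by rewrite mulKf// gt_eqF// sqrtr_gt0 divr_gt0// pi_gt0.
Qed.

(** The cosine terms are only of order [1 / n], so the partial sums are dominated instead of the
    terms. Young's inequality [|D| <= (s + D ^ 2 / s) / 2] with [s = sqrt (k + 1)] balances the mean
    square [O (k)] of [D], and the [k]-th majorant has integral [O (k ^ (- 3/2))] for large [k]. *)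
Lemma has_integral_K_1 r : 0 < r ->
  exists I, has_integral (fun t => expR (- (r * t)) * K_ 1 t) I /\
  series (fun n => (c_ 1)^-1 * mathieu_coef 1 r n) @ \oo --> I.
Proof.
(* One factor [exp (- a t)] absorbs the [t] in front of the cosine sum, the other is the weight of
   the mean square. *)
move=> r0; pose a := r / 2; have a0 : 0 < a by rewrite divr_gt0.
have [C HC] := powR_le_expR (@ler01 R) a0.
have C0 : 0 <= C.
  have := HC 1 ltr01; rewrite powR1 => /(le_trans ler01).
  by rewrite pmulr_lge0 ?expR_gt0.
pose sq : R := Num.sqrt (2 / pi).
have sq0 : 0 <= sq by rewrite sqrtr_ge0.
pose A := sq * (1 + C).
have A0 : 0 <= A by rewrite mulr_ge0 ?addr_ge0.
pose u (k : nat) : R := k.+1%:R `^ (- (1 + 1)).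
pose q (k : nat) : R := k.+1%:R * k.+2%:R.
have q0 k : 0 < q k by rewrite mulr_gt0.
pose s (k : nat) : R := Num.sqrt k.+1%:R.
have s0 k : 0 < s k by rewrite sqrtr_gt0.
pose E t := expR (- (a * t)).
pose DD n t := E t * cos_sum n t ^+ 2.
pose I2 n := \int[mu]_(t in D0) DD n t.
have hDD n : has_integral (DD n) (I2 n).
  have [I hI _] := has_integral_cos_sum_sqr n a0.
  by apply: integrable_has_integral; exact: hI.1.
pose B : R := 4 * a + a^-1.
have B0 : 0 <= B by rewrite addr_ge0 ?mulr_ge0 ?invr_ge0// ltW.
have I2B n : I2 n <= n%:R * B.
  have [I hI IB] := has_integral_cos_sum_sqr n a0.
  by rewrite (has_integral_unique (hDD n) hI).
(* The first summand majorises the sine series. The second supplies, once, the constant 1 that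
   bounds the Abel boundary term. The third is Young's bound of [|cos_sum k.+1 t| / q k]. *)
pose g (k : nat) t := A * (u k * E t + (k == 0%N)%:R * E t +
   (2 * q k)^-1 * (s k * E t + (s k)^-1 * DD k.+1 t)).
pose w (k : nat) := A * (u k * a^-1 + (k == 0%N)%:R * a^-1 +
   (2 * q k)^-1 * (s k * a^-1 + (s k)^-1 * I2 k.+1)).
have hE : has_integral E a^-1 by exact: has_integral_expR.
have hg k : has_integral (g k) (w k).
  apply: has_integralZ; apply: has_integralD; first apply: has_integralD; try exact: has_integralZ.
  apply: has_integralZ; apply: has_integralD; exact: has_integralZ.
have g0 k t : 0 < t -> 0 <= g k t.
  move=> _; have E0 : 0 <= E t by exact: expR_ge0.
  apply: mulr_ge0 => //; apply: addr_ge0; first by rewrite addr_ge0 ?mulr_ge0 ?powR_ge0.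
  apply: mulr_ge0; first by rewrite invr_ge0 mulr_ge0// ltW.
  by rewrite addr_ge0// mulr_ge0 ?invr_ge0 ?(ltW (s0 k))// mulr_ge0 ?sqr_ge0.
have w0 k : 0 <= w k.
  rewrite -(has_integral_Rintegral (hg k)); apply: Rintegral_ge0 => t.
  by rewrite /= in_itv/= andbT; exact: g0.
have cw : cvgn (series w).
  pose v (k : nat) := A * a^-1 * u k + A * a^-1 * (k == 0%N)%:R + A * (a^-1 + B) * k.+1%:R `^ (- (1 + 2^-1)).
  have cv : cvgn (series v).
    have -> : v = (fun k => A * a^-1 * u k) \+ (fun k => A * a^-1 * (k == 0%N)%:R) \+ (fun k => A * (a^-1 + B) * k.+1%:R `^ (- (1 + 2^-1))) by [].
    apply: is_cvg_seriesD; first apply: is_cvg_seriesD; apply: is_cvg_seriesZ.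
    - exact: is_cvg_series_natr_powR.
    - apply/cvg_ex; exists 1; apply: cvg_near_cst; near=> n.
      have n0 : (0 < n)%N by near: n; exact: nbhs_infty_gt.
      rewrite /series/= -(prednK n0) big_nat_recl//= big1_seq ?addr0//.
    - by apply: is_cvg_series_natr_powR; rewrite invr_gt0.
  have wv k : w k <= v k.
    have kp : 0 < k.+1%:R :> R by rewrite ltr0n.
    have hs : (2 * q k)^-1 * s k <= k.+1%:R `^ (- (1 + 2^-1)).
      have -> : - (1 + 2^-1) = - 2%:R + 2^-1 :> R by field.
      rewrite powRD ?(gt_eqF kp) ?implybT// powR_invn ?(ltW kp)// powR12_sqrt ?(ltW kp)//.
      apply: ler_wpM2r; first exact: ltW.
      have p1 : 0 < 2 * q k by rewrite mulr_gt0.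
      have p2 : 0 < k.+1%:R ^+ 2 :> R by rewrite exprn_gt0.
      rewrite (lef_pV2 p1 p2) /q -natrX -!natrM ler_nat.
      by rewrite expnS expn1 mulnCA leq_pmul2l// mulSn mul1n -[leqLHS]addn0 leq_add.
    have hI : s k * a^-1 + (s k)^-1 * I2 k.+1 <= s k * (a^-1 + B).
      rewrite mulrDr lerD2l mulrC ler_pdivrMr//.
      have -> : s k * B * s k = k.+1%:R * B.
        by rewrite mulrAC -expr2 sqr_sqrtr ?(ltW kp)// mulrC.
      exact: I2B.
    rewrite /w /v mulrDr; apply: lerD.
      by rewrite -subr_ge0 (_ : _ - _ = 0)//; ring.
    rewrite -mulrA; apply: ler_wpM2l => //.
    apply: (@le_trans _ _ ((2 * q k)^-1 * (s k * (a^-1 + B)))).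
      by apply: ler_wpM2l => //; rewrite invr_ge0 mulr_ge0// ltW.
    rewrite mulrA [leRHS]mulrC; apply: ler_wpM2r => //.
    by rewrite addr_ge0// invr_ge0 ltW.
  by apply: (series_le_cvg w0 _ wv cv) => k; exact: le_trans (w0 k) (wv k).
have N0 := @countable_sin_half_eq0 R.
set N := [set t | _] in N0.
have sN t : 0 < t -> ~ N t -> sin (t / 2) != 0.
  by move=> t0 Nt; apply/eqP => st; apply: Nt; split.
pose f (n : nat) t := series (fun n => expR (- (r * t)) * (t `^ (1 + 1 / 2) * bessel_term_mathieu 1 n t)) n.
have hf n : has_integral (f n) (series (fun n => (c_ 1)^-1 * mathieu_coef 1 r n) n).
  by rewrite /f /series/=; apply: has_integral_sum => k; exact: has_integral_mathieu_term.
have fF t : 0 < t -> ~ N t -> f ^~ t @ \oo --> expR (- (r * t)) * K_ 1 t.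
  move=> t0 Nt; rewrite (_ : f ^~ t = (fun n => expR (- (r * t)) *
     (Num.sqrt (2 / pi) * (sin_div_sum n t - t * cos_div_sum n t)))).
    by apply: cvgMr; apply: cvg_K1 => //; exact: sN.
  by apply/funext => n; exact: series_mathieu_term1.
exists (\int[mu]_(t in D0) (expR (- (r * t)) * K_ 1 t)).
apply: (has_integral_dominated N0 _ hf hg g0 cw _ fF).
  apply: measurable_cvg_countable N0 _ fF => n; exact: has_integral_measurable (hf n).
(* Taking [n.+1] terms ensures that the summand [k = 0], which carries the constant 1, is present
   even for [n = 0]. *)
move=> n t t0; apply: (@le_trans _ _ (\sum_(0 <= k < n.+1) (g k t)%:E)%E); last first.
  by apply: nneseries_lim_ge => k _ _; rewrite lee_fin; exact: g0.
rewrite sumEFin lee_fin /f series_mathieu_term1//.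
have E0 : 0 <= E t by exact: expR_ge0.
have rE : expR (- (r * t)) = E t * E t by rewrite /E -expRD; congr expR; rewrite /a; field.
have E1 : E t <= 1 by rewrite /E expR_le1 oppr_le0 mulr_ge0// ltW.
have tE : t * E t <= C.
  have := HC t t0; rewrite powRr1 ?(ltW t0)// /E expRN.
  by rewrite ler_pdivrMr ?expR_gt0.
have Dk k : `|cos_sum k.+1 t| / q k <= (2 * q k)^-1 * (s k + (s k)^-1 * cos_sum k.+1 t ^+ 2).
  have qn : q k != 0 by rewrite gt_eqF.
  have sn : s k != 0 by rewrite gt_eqF.
  rewrite -(real_normK (num_real (cos_sum k.+1 t))) -subr_ge0.
  have -> : (2 * q k)^-1 * (s k + (s k)^-1 * `|cos_sum k.+1 t| ^+ 2) - `|cos_sum k.+1 t| / q k =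
     (2 * q k)^-1 * (s k)^-1 * (s k - `|cos_sum k.+1 t|) ^+ 2.
    move: (q k) (s k) (`|_|) qn sn => x y z x0 y0; by field; rewrite x0 y0.
  apply: mulr_ge0; last exact: sqr_ge0.
  by apply: mulr_ge0; rewrite invr_ge0; [exact: mulr_ge0 (ler0n _ 2) (ltW (q0 k))|exact: ltW (s0 k)].
have su k : 0 <= u k by exact: powR_ge0.
pose P := \sum_(0 <= k < n.+1) u k.
pose V := \sum_(0 <= k < n.+1) ((2 * q k)^-1 * (s k + (s k)^-1 * cos_sum k.+1 t ^+ 2)).
have hP : `|sin_div_sum n t| <= P.
  apply: (le_trans (norm_sin_div_sum n t)).
  by rewrite /P big_nat_recr//= lerDl.
have hV : `|cos_div_sum n t| <= 1 + V.
  apply: (le_trans (norm_cos_div_sum n t)); rewrite lerD2l /V big_nat_recr//=.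
  rewrite ler_wpDr//; last by apply: ler_sum => k _; exact: Dk.
  by apply: le_trans (Dk n); rewrite divr_ge0// ltW.
have -> : \sum_(0 <= k < n.+1) g k t = A * E t * (P + 1 + V).
  rewrite /g -mulr_sumr -mulrA; congr (_ * _).
  rewrite !big_split/= -!mulr_suml -/P mulrDr mulrDr; congr (_ + _).
    rewrite mulrC; congr (_ + _); rewrite mulrC; congr (_ * _).
    rewrite big_nat_recl//= big1_seq ?addr0//.
  rewrite /V mulr_sumr; apply: eq_bigr => k _; rewrite /DD; ring.
have P0 : 0 <= P by apply: sumr_ge0 => k _.
have V0 : 0 <= V.
  by apply: sumr_ge0 => k _; apply: le_trans (Dk k); rewrite divr_ge0// ltW.
have h1 : `|sin_div_sum n t - t * cos_div_sum n t| <= P + t * (1 + V).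
  apply: (le_trans (ler_normB _ _)); apply: lerD => //.
  by rewrite normrM (ger0_norm (ltW t0)); apply: ler_wpM2l => //; exact: ltW.
have h2 : E t * `|sin_div_sum n t - t * cos_div_sum n t| <= P + C * (1 + V).
  apply: (le_trans (ler_wpM2l E0 h1)); rewrite mulrDr; apply: lerD.
    by rewrite ler_piMl.
  by rewrite mulrA (mulrC (E t)); apply: ler_wpM2r => //; rewrite addr_ge0.
rewrite rE normrM (ger0_norm (mulr_ge0 E0 E0)) normrM (ger0_norm sq0).
have -> : E t * E t * (sq * `|sin_div_sum n t - t * cos_div_sum n t|) =
   sq * E t * (E t * `|sin_div_sum n t - t * cos_div_sum n t|).
  by move: (E t) (`|_|) => x y; ring.
have -> : A * E t * (P + 1 + V) = sq * E t * ((1 + C) * (P + 1 + V)) by rewrite /A; ring.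
apply: ler_wpM2l; first by rewrite mulr_ge0.
apply: (le_trans h2); rewrite -subr_ge0.
have -> : (1 + C) * (P + 1 + V) - (P + C * (1 + V)) = 1 + V + C * P by ring.
by rewrite addr_ge0 ?mulr_ge0 ?addr_ge0.
Unshelve. all: by end_near. Qed.

End mathieu_series.

(** * The zeta value *)

Section Mathieu.
Context {R : realType}.
Notation mu := (@lebesgue_measure R).
Notation D0 := (`]0, +oo[%classic : set R).
Implicit Types (m t r : R).

Lemma has_integral_K m r : 1 <= m -> 0 < r ->
  exists I, has_integral (fun t => expR (- (r * t)) * K_ m t) I /\
  series (fun n => (c_ m)^-1 * mathieu_coef m r n) @ \oo --> I.
Proof.
rewrite le_eqVlt => /predU1P[<-|m1 r0]; first exact: has_integral_K_1.
exact: has_integral_K_gt1.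
Qed.

Lemma laplace_K1_K r : 0 < r ->
  laplace_integrable (@K R) r /\ laplace (@K R) r = c_ 1 * laplace (K_ 1) r.
Proof.
move=> r0; have [I [hI _]] := has_integral_K (lexx 1) r0.
have h : has_integral (fun t => expR (- (r * t)) * K t) (c_ 1 * I).
  apply: (@eq_has_integral_countable _ _ _ _ _ countable_sin_half_eq0 _ (has_integralZ (c_ 1) hI)).
  move=> t t0 Nt; rewrite K_eq_K1//; first by rewrite mulrCA.
  by apply/eqP => st; apply: Nt; split.
split; first exact: h.1.
by rewrite /laplace (has_integral_Rintegral h) (has_integral_Rintegral hI).
Qed.

(** Factor [k ^ 2] out of the denominator and use [1 - (m + 1) z <= (1 + z) ^ (- (m + 1)) <= 1] at
    [z = r ^ 2 / k ^ 2]. Bounding [z] by [r ^ 2] loses decay but keeps the exponent of the zeta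
    series, so the errors sum to a multiple of the same zeta value. *)
Lemma mathieu_coef_dist m r (n : nat) : 0 <= m ->
  `|2 * n.+1%:R `^ (- (2 * m + 1)) - mathieu_coef m r n| <=
  2 * (m + 1) * r ^+ 2 * n.+1%:R `^ (- (1 + 2 * m)).
Proof.
move=> m0; set k : R := n.+1%:R.
have k1 : 1 <= k by rewrite ler1n.
have k0 : 0 < k by exact: lt_le_trans k1.
have kn : k != 0 by rewrite gt_eqF.
pose z := r ^+ 2 / k ^+ 2.
have z0 : 0 <= z by rewrite divr_ge0 ?sqr_ge0.
have zr : z <= r ^+ 2.
  by rewrite /z ler_pdivrMr ?exprn_gt0// ler_peMr ?sqr_ge0// exprn_ege1.
have z1 : 0 < 1 + z by rewrite ltr_wpDr.
have p0 : 0 <= m + 1 by rewrite addr_ge0.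
rewrite (_ : - (2 * m + 1) = - (1 + 2 * m)); last by rewrite addrC.
set P := k `^ (- (1 + 2 * m)).
have P0 : 0 <= P by exact: powR_ge0.
have -> : mathieu_coef m r n = 2 * P * (1 + z) `^ (- (m + 1)).
  rewrite /mathieu_coef -/k.
  have -> : k ^+ 2 + r ^+ 2 = k ^+ 2 * (1 + z) by rewrite /z; field.
  rewrite powRM ?sqr_ge0 ?(ltW z1)// invfM powRN mulrA; congr (_ * _).
  rewrite -mulrA; congr (_ * _).
  rewrite -powR_mulrn ?(ltW k0)// -powRrM -powRN /P.
  have -> : - (1 + 2 * m) = 1 + - (2 * (m + 1)) by ring.
  by rewrite (@powRD _ k 1) ?kn ?implybT// powRr1 ?(ltW k0).
have le1 : (1 + z) `^ (- (m + 1)) <= 1.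
  rewrite powRN invf_le1 ?powR_gt0//.
  have h : 1 `^ (m + 1) <= (1 + z) `^ (m + 1).
    by apply: ge0_ler_powR => //; rewrite ?nnegrE ?(ltW z1)// lerDl.
  by rewrite powR1 in h.
have ge1 : 1 - (m + 1) * z <= (1 + z) `^ (- (m + 1)).
  rewrite /powR gt_eqF//; apply: le_trans (expR_ge1Dx _).
  rewrite lerD2l mulNr lerN2; apply: ler_wpM2l => //.
  by apply: le_ln1Dx; rewrite (lt_le_trans _ z0).
have -> : 2 * P - 2 * P * (1 + z) `^ (- (m + 1)) = 2 * P * (1 - (1 + z) `^ (- (m + 1))) by ring.
rewrite ger0_norm; last by rewrite !mulr_ge0// subr_ge0.
have -> : 2 * (m + 1) * r ^+ 2 * P = 2 * P * ((m + 1) * r ^+ 2) by ring.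
apply: ler_wpM2l; first by rewrite mulr_ge0.
apply: (@le_trans _ _ ((m + 1) * z)); last exact: ler_wpM2l.
by move: ge1; move: (_ `^ _) ((m + 1) * z) => u v; lra.
Qed.

Lemma is_cvg_zeta m : 1 <= m -> cvgn (series (fun n => n.+1%:R `^ (- (1 + 2 * m)) : R)).
Proof. by move=> m1; apply: is_cvg_series_natr_powR; lra. Qed.

Lemma zetaE m : 1 <= m ->
  zeta (2 * m + 1) = limn (series (fun n => n.+1%:R `^ (- (1 + 2 * m)) : R)).
Proof.
move=> m1; apply: (lim_sum_from1 (f := fun n => n%:R `^ (- (2 * m + 1)))).
by rewrite (addrC (2 * m)); exact: is_cvg_zeta.
Qed.

Lemma gen_mathieu_zeta m r : 1 <= m -> 0 < r ->
  `|2 * zeta (2 * m + 1) - gen_mathieu m r| <= 2 * (m + 1) * r ^+ 2 * zeta (2 * m + 1).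
Proof.
move=> m1 r0; have m0 : 0 <= m by lra.
have [I [hI hc]] := has_integral_K m1 r0.
have [_ ->] := gen_mathieu_laplace m1 hI hc.
rewrite /laplace (has_integral_Rintegral hI) zetaE//.
have cz := is_cvg_zeta m1.
set Z := limn _ in cz *.
pose d (n : nat) : R := 2 * n.+1%:R `^ (- (2 * m + 1)) - mathieu_coef m r n.
have c1 : series d n @[n --> \oo] --> 2 * Z - c_ m * I.
  rewrite (_ : series d = (fun n => 2 * series (fun n => n.+1%:R `^ (- (1 + 2 * m))) n -
      c_ m * series (fun n => (c_ m)^-1 * mathieu_coef m r n) n)).
    by apply: cvgB; apply: cvgMr.
  apply/funext => n; rewrite /series/= !mulr_sumr -sumrB; apply: eq_bigr => k _.
  by rewrite mulVKf ?gt_eqF ?c_gt0// /d (addrC (2 * m)).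
have c2 : `|series d n| @[n --> \oo] --> `|2 * Z - c_ m * I| by apply: cvg_norm.
have c3 : 2 * (m + 1) * r ^+ 2 * series (fun n => n.+1%:R `^ (- (1 + 2 * m))) n @[n --> \oo] -->
   2 * (m + 1) * r ^+ 2 * Z by apply: cvgMr.
rewrite -(cvg_lim _ c2)// -(cvg_lim _ c3)//.
apply: ler_lim; [by apply/cvg_ex; eexists; exact: c2|by apply/cvg_ex; eexists; exact: c3|].
apply: nearW => n; apply: (le_trans (ler_norm_sum _ _ _)).
by rewrite /series/= mulr_sumr; apply: ler_sum => k _; exact: mathieu_coef_dist.
Qed.

Lemma abel_integral_K m : 1 <= m ->
  abel_integral (K_ m) ((c_ m)^-1 * (2 * zeta (2 * m + 1))).
Proof.
move=> m1; have cm0 : 0 < c_ m := c_gt0 m1.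
have L r : 0 < r -> laplace_integrable (K_ m) r /\ gen_mathieu m r = c_ m * laplace (K_ m) r.
  by move=> r0; have [I [hI hc]] := has_integral_K m1 r0; exact: gen_mathieu_laplace hI hc.
split; first by move=> r /L[].
pose Z := zeta (2 * m + 1).
(* The constant of [gen_mathieu_zeta], rescaled by [c_ m]: the Laplace transform approaches its
   limit at the rate [B * r ^ 2]. *)
pose B := (c_ m)^-1 * (2 * (m + 1) * Z).
have bound r : 0 < r -> `|(c_ m)^-1 * (2 * Z) - laplace (K_ m) r| <= B * r ^+ 2.
  move=> r0; have [_ e] := L r r0.
  have -> : laplace (K_ m) r = (c_ m)^-1 * gen_mathieu m r by rewrite e mulKf// gt_eqF.
  rewrite -mulrBr normrM ger0_norm ?invr_ge0 ?(ltW cm0)//.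
  have -> : B * r ^+ 2 = (c_ m)^-1 * (2 * (m + 1) * r ^+ 2 * Z) by rewrite /B; ring.
  by apply: ler_wpM2l; [rewrite invr_ge0 ltW|exact: gen_mathieu_zeta].
have c0 : B * r ^+ 2 @[r --> 0^'+] --> 0.
  have : B * r ^+ 2 @[r --> 0^'+] --> B * 0 ^+ 2.
    by apply: cvg_at_right_filter; apply: cvgMr; exact: exprn_continuous.
  by rewrite expr0n mulr0.
apply/cvgrPdist_le => eps eps0; move/cvgrPdist_le : c0 => /(_ _ eps0) c0.
near=> r; have r0 : 0 < r by near: r; exact: nbhs_right_gt.
apply: (le_trans (bound r r0)).
have : `|0 - B * r ^+ 2| <= eps by near: r.
by rewrite sub0r normrN; apply: le_trans; exact: ler_norm.
Unshelve. all: by end_near. Qed.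

End Mathieu.

Theorem theorem5 (R : realType) (mu : R) (hmu : 1 <= mu) :
  (forall r : R, 0 < r ->
     laplace_integrable (K_ mu) r /\
     gen_mathieu mu r = c_ mu * laplace (K_ mu) r)
  /\ (exists l : R,
        abel_integral (K_ mu) l /\ zeta (2 * mu + 1) = c_ mu / 2 * l)
  /\ (forall r : R, 0 < r ->
        laplace_integrable (@K R) r /\
        mathieu r = laplace (@K R) r).
Proof.
split; last split.
- move=> r r0; have [I [hI hc]] := has_integral_K hmu r0.
  exact: gen_mathieu_laplace hI hc.
- exists ((c_ mu)^-1 * (2 * zeta (2 * mu + 1))); split; first exact: abel_integral_K.
  have cn : c_ mu != 0 by rewrite gt_eqF// c_gt0.
  by move: (c_ mu) (zeta _) cn => x y x0; field.
- move=> r r0; have [iK ->] := laplace_K1_K r0; split=> //.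
  have [I [hI hc]] := has_integral_K (lexx 1) r0.
  by rewrite /mathieu; have [_ ->] := gen_mathieu_laplace (lexx 1) hI hc.
Qed.
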